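(* Let $Q$ be the Viallet polynomial and let $\mathfrak R$ be the pseudo-difference operator $$\begin{aligned}\mathfrak R ={}& h\,h_{-1}w^2w_1^2\,\mathcal S^2+h\,h_{-1}w^2w_{-1}^2\,\mathcal S^{-2}+2K^{(1)}K^{(2)}\Big(\tfrac1h\mathcal S+\mathcal S^{-1}\circ\tfrac1h\Big)\\&-w^2\big(h_{-1}h_1w_1^2+h_{-2}h\,w_{-1}^2\big)+\tfrac{2}{h_{-1}}\big(K^{(1)}K^{(2)}_{-1}+K^{(2)}K^{(1)}_{-1}\big)\\&+2K^{(1)}\Delta^{-1}\circ\Big(\tfrac{K^{(2)}_{-1}}{h_{-1}}-\tfrac{K^{(2)}_1}{h}\Big)+2K^{(2)}\Delta^{-1}\circ\Big(\tfrac{K^{(1)}_{-1}}{h_{-1}}-\tfrac{K^{(1)}_1}{h}\Big).\end{aligned}$$ Then $\mathfrak R$ is a recursion operator of the difference equation $Q=0$; that is, whenever $K\in\mathcal F_Q$ is a symmetry of $Q=0$ and $K\in\mathrm{Dom}(\mathfrak R)$, the element $\mathfrak R(K)\in\mathcal F_Q$ is again a symmetry of $Q=0$.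
   Context: **Equation.** Variables $u_{p,q}$, $(p,q)\in\mathbb Z^2$, $U=\{u_{p,q}\}$; commuting shift automorphisms $\mathcal S:u_{p,q}\mapsto u_{p+1,q}$, $\mathcal T:u_{p,q}\mapsto u_{p,q+1}$ of $\mathbb C[U]$. The Viallet polynomial with complex parameters $a_1,\dots,a_7$ is $$\begin{aligned}Q={}&a_1u_{0,0}u_{1,0}u_{0,1}u_{1,1}+a_2(u_{0,0}u_{1,0}u_{0,1}+u_{1,0}u_{0,1}u_{1,1}+u_{0,1}u_{1,1}u_{0,0}+u_{1,1}u_{0,0}u_{1,0})\\&+a_3(u_{0,0}u_{1,0}+u_{0,1}u_{1,1})+a_4(u_{1,0}u_{0,1}+u_{0,0}u_{1,1})+a_5(u_{0,0}u_{0,1}+u_{1,0}u_{1,1})\\&+a_6(u_{0,0}+u_{1,0}+u_{0,1}+u_{1,1})+a_7.\end{aligned}$$ Standing assumption: $Q$ is irreducible and $\partial_{u_{i,j}}Q\neq0$ for $i,j\in\{0,1\}$ (it is affine-linear in each variable). **Field.** $J_Q\subset\mathbb C[U]$ is the ideal generated by all $\mathcal S^p\mathcal T^qQ$, $(p,q)\in\mathbb Z^2$; it is prime and $\mathcal F_Q$ is the field of fractions of $\mathbb C[U]/J_Q$. $\mathcal S,\mathcal T$ act on it as automorphisms. Since $Q=0$ can be solved uniquely and rationally for each of its four variables, every element of $\mathcal F_Q$ is uniquely represented by a rational function of the variables $u_{n,0},u_{0,n}$, $n\in\mathbb Z$. Equalities between elements are in $\mathcal F_Q$. Notation: $f_k=\mathcal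 S^k(f)$, $Q_{u_{i,j}}=\partial_{u_{i,j}}Q$. **Functions.** $h=h(u_{0,0},u_{1,0})=Q\,\partial_{u_{0,1}}\partial_{u_{1,1}}Q-\partial_{u_{0,1}}Q\,\partial_{u_{1,1}}Q$ (a polynomial depending only on $u_{0,0},u_{1,0}$), $w=\frac1{u_{1,0}-u_{-1,0}}$, $K^{(1)}=hw-\frac12\partial_{u_{1,0}}h$, $K^{(2)}=h\,h_{-1}w^2(w_1+w_{-1})$. **Symmetries.** $K\in\mathcal F_Q$ is a symmetry of $Q=0$ if $D_Q(K)=0$ in $\mathcal F_Q$, where $D_Q=\sum_{i,j\in\{0,1\}}Q_{u_{i,j}}\mathcal S^i\mathcal T^j$. **Operators.** $\Delta=\mathcal S-1$. Weakly nonlocal pseudo-difference operators are finite sums $B=B_0+\sum_k\alpha_k\Delta^{-1}\circ\beta_k$ with $\alpha_k,\beta_k\in\mathcal F_Q$ and $B_0$ a finite sum $\sum_na_n\mathcal S^n$ ($n\in\mathbb Z$, $a_n\in\mathcal F_Q$). $\Delta^{-1}$ is defined on $\mathrm{Im}\,\Delta=\Delta\mathcal F_Q$: $\Delta^{-1}(a)$ denotes an element $b\in\mathcal F_Q$ with $\mathcal S(b)-b=a$. It is understood that $\mathrm{Ker}\,\Delta=\mathbb C$ in $\mathcal F_Q$, so $b$ is determined up to an additive complex constant; this constant of integration is disregarded. $\mathrm{Dom}(B)=\{a\in\mathcal F_Q: B(a)\in\mathcal F_Q\}$, i.e. the set of $a$ for which the action of $B$ is defined. *)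

(* Defs.v *)
From HB Require Import structures.
From mathcomp Require Import all_boot all_order all_algebra.
From mathcomp Require Import finmap.
From mathcomp Require Import reals.
From mathcomp Require Import complex.
From mathcomp Require Import monalg mpoly.

Set Implicit Arguments.
Unset Strict Implicit.
Unset Printing Implicit Defensive.

Import GRing.Theory.

Local Open Scope ring_scope.

(* The ring C[U] in the variables u_{p,q}, (p, q) in Z^2: the monoid algebra of
   the free commutative monoid on Z x Z. *)
Notation CU C := {malg C[{cmonom (int * int)%type}]}.

Definition cstU (C : fieldType) (c : C) : CU C := malgC c.
Definition varU (C : fieldType) (p q : int) : CU C := mkmalgU (ucm (p, q)) 1.

(* Polynomials in the four unknowns u_{i,j}, i, j in {0,1}, the unknown u_{i,j}
   having index i + 2 j; monalg shadows the notation {mpoly C[4]} of mpoly. *)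
Notation poly4 C := (mpoly.mpoly 4 C).
Definition corner (i j : bool) : 'I_4 := inord (i + 2 * j)%N.

Section Quad.
Variable C : fieldType.
Implicit Types P : poly4 C.

Definition vx (i j : bool) : poly4 C := mpolyX C (mnm1 (corner i j)).

Definition pd (i j : bool) P : poly4 C := mderiv (corner i j) P.

(* S^p T^q P as an element of C[U]. *)
Definition inst (p q : int) P : CU C :=
  mpoly.mmap (@cstU C)
    (fun k : 'I_4 => varU C (p + (k %% 2)%N%:Z) (q + (k %/ 2)%N%:Z)) P.

Definition viallet (a1 a2 a3 a4 a5 a6 a7 : C) : poly4 C :=
  let u00 := vx false false in let u10 := vx true false in
  let u01 := vx false true in let u11 := vx true true in
  a1 *: (u00 * u10 * u01 * u11)
  + a2 *: (u00 * u10 * u01 + u10 * u01 * u11 + u01 * u11 * u00 + u11 * u00 * u10)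
  + a3 *: (u00 * u10 + u01 * u11)
  + a4 *: (u10 * u01 + u00 * u11)
  + a5 *: (u00 * u01 + u10 * u11)
  + a6 *: (u00 + u10 + u01 + u11)
  + a7 *: 1.

Definition irreducible_elt P : Prop :=
  [/\ P != 0, P \isn't a GRing.unit
    & forall A B : poly4 C, P = A * B ->
        A \is a GRing.unit \/ B \is a GRing.unit].

(* J_Q, the ideal generated by all S^p T^q Q. *)
Definition JQ (Q : poly4 C) (P : CU C) : Prop :=
  exists s : seq (CU C * (int * int)),
    P = \sum_(t <- s) t.1 * inst t.2.1 t.2.2 Q.

Definition hpoly (Q : poly4 C) : poly4 C :=
  Q * pd false true (pd true true Q) - pd false true Q * pd true true Q.

End Quad.

(* (F, proj) is the field of fractions of A / J (in particular J is prime),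
   proj being the composite A -> A / J -> F. *)
Definition is_frac_of_quotient (A : comNzRingType) (J : A -> Prop)
    (F : fieldType) (proj : {rmorphism A -> F}) : Prop :=
  (forall a, proj a = 0 <-> J a)
  /\ (forall x, exists a b, proj b != 0 /\ x = proj a / proj b).

Section FQ.
Variables (C : fieldType) (Q : poly4 C).
Variables (F : fieldType) (proj : {rmorphism CU C -> F}).
Variable sh : int -> int -> {rmorphism F -> F}.

(* sh p q is the automorphism S^p T^q of F; a field endomorphism with these
   values is unique, and sh (- p) (- q) is its inverse. *)
Definition is_shift_action : Prop :=
  forall p q : int,
    (forall c, sh p q (proj (cstU c)) = proj (cstU c))
    /\ (forall i j, sh p q (proj (varU C i j)) = proj (varU C (i + p) (j + q))).

Definition KerDelta_is_C : Prop :=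
  forall b : F, sh 1 0 b = b -> exists c : C, b = proj (cstU c).

Definition DQ (K : F) : F :=
  \sum_(i : bool) \sum_(j : bool)
     proj (inst 0 0 (pd i j Q)) * sh (i : nat)%:Z (j : nat)%:Z K.

Definition symmetry (K : F) : Prop := DQ K = 0.

(* The operator \sum_k a_k S^{n_k} + \sum_k alpha_k Delta^{-1} o beta_k. *)
Record wnl_op := WnlOp {
  local_part : seq (F * int);
  nonlocal_part : seq (F * F)
}.

(* wnl_value B a r : "r = B(a)".  A choice bs of the elements
   Delta^{-1}(beta_k a) is existentially quantified, so B(a) has several values
   when Delta^{-1} occurs, one for each choice of the integration constants. *)
Definition wnl_value (B : wnl_op) (a r : F) : Prop :=
  exists bs : seq F,
    [/\ size bs = size (nonlocal_part B),
        forall k, (k < size bs)%N ->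
          sh 1 0 bs`_k - bs`_k = (nth (0, 0) (nonlocal_part B) k).2 * a
      & r = \sum_(t <- local_part B) t.1 * sh t.2 0 a
            + \sum_(k < size bs) (nth (0, 0) (nonlocal_part B) k).1 * bs`_k].

Definition Dom (B : wnl_op) (a : F) : Prop := exists r, wnl_value B a r.

Definition recursion_operator (B : wnl_op) : Prop :=
  forall K, symmetry K -> Dom B K -> forall r, wnl_value B K r -> symmetry r.

Definition shS (k : int) (f : F) : F := sh k 0 f.

Definition h : F := proj (inst 0 0 (hpoly Q)).
Definition w : F := (proj (varU C 1 0 - varU C (-1) 0))^-1.
Definition K1 : F :=
  h * w - 2^-1 * proj (inst 0 0 (pd true false (hpoly Q))).
Definition K2 : F :=
  h * shS (-1) h * w ^+ 2 * (shS 1 w + shS (-1) w).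

(* In the third and fourth local terms,
   2 K1 K2 (h^{-1} S + S^{-1} o h^{-1}) is expanded using
   S^{-1} o h^{-1} = h_{-1}^{-1} S^{-1}. *)
Definition opR : wnl_op := {|
  local_part :=
    [:: (h * shS (-1) h * w ^+ 2 * (shS 1 w) ^+ 2, 2);
        (h * shS (-1) h * w ^+ 2 * (shS (-1) w) ^+ 2, -2);
        (2 * K1 * K2 * h^-1, 1);
        (2 * K1 * K2 * (shS (-1) h)^-1, -1);
        (- (w ^+ 2 * (shS (-1) h * shS 1 h * (shS 1 w) ^+ 2
                      + shS (-2) h * h * (shS (-1) w) ^+ 2)), 0);
        (2 / shS (-1) h * (K1 * shS (-1) K2 + K2 * shS (-1) K1), 0) ];
  nonlocal_part :=
    [:: (2 * K1, shS (-1) K2 / shS (-1) h - shS 1 K2 / h);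
        (2 * K2, shS (-1) K1 / shS (-1) h - shS 1 K1 / h) ]
|}.

End FQ.

(* Main.v *)
(** Write [a], [b], [c], [d] for the derivatives of [Q] with respect to
    [u_{1,1}], [u_{0,1}], [u_{1,0}], [u_{0,0}].  On shell [h = - a b],
    [T h = - c d], and [g = - a c] is the analogue of [h] for the other
    direction.  Between two adjacent quadrilaterals of a row,
    [b w_1 = - c_1 (T w)_1] and [a_1 w_1 = - d (T w)_1].  These relations, and
    the fact that [K1] and [K2] are symmetries, make [D_Q o R] applied to a
    symmetry [K] vanish identically, provided the two nonlocal terms are
    transported exactly by [T]: if [S th - th = (L S K - S L K) / h], where [L]
    is [2 K1] or [K2], then [T th - th = (T L K - T K L) / g].

    Since this is a conservation law, the two sides of the latter equation
    differ by some [c] in [Ker Delta = C], and the point is that [c = 0].  The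
    reflections [i : u_{p,q} -> u_{-p,q}] and [j : u_{p,q} -> u_{p,-q}] act on
    the field, [i L = - L] and [j L = L], and each of them changes the sign of
    [c].  Hence [4 c] is the constant attached to [K - i K - j K + i j K], and
    this element is zero for every symmetry [K].

    To see this, take four embeddings [f_{s,r}] of the field into [E] that
    agree on [u_{p,q}] for [p < 1] when only [s] changes and for [q < 1] when
    only [r] changes.  Composing with negative shifts, the equation
    [D_Q K = 0] and the finite support of [K] give
    [f_{0,0} K - f_{1,0} K - f_{0,1} K + f_{1,1} K = 0] by induction.  Embeddings
    with values in rational functions of one variable, defined by initial data
    on the two axes, connect the identity to [i] and [j] by steps changing one
    half-axis at a time; they are embeddings because they specialize to the
    generic solution. *)
From HB Require Import structures.
Require Import Defs.
From mathcomp Require Import all_boot all_order all_algebra finmap.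
From mathcomp Require Import monalg.
From mathcomp Require Import ring zify.
Set Implicit Arguments.
Unset Strict Implicit.
Unset Printing Implicit Defensive.
Import Order.TTheory GRing.Theory Num.Theory.
Local Open Scope ring_scope.

(** * Identities on the quadrilaterals of a row *)

Section Polys.
Variables (F : fieldType) (t : nat -> F).
Implicit Types x X y Y : F.

(* [Qf t] is [Q] with [a_i = t i] at [(u00, u10, u01, u11)], [Af] its derivative in
   [u11], [d2f 3], [d2f 4] and [d2f 5] the mixed second derivatives; [hf] is [h],
   [dhf] its derivative in [u10], [gf] the analogue of [h] for [u00, u01]. *)
Definition Qf x X y Y : F :=
  t 1 * (x * X * y * Y)
  + t 2 * (x * X * y + X * y * Y + y * Y * x + Y * x * X)
  + t 3 * (x * X + y * Y) + t 4 * (X * y + x * Y) + t 5 * (x * y + X * Y)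
  + t 6 * (x + X + y + Y) + t 7.
Definition Af x X y : F :=
  t 1 * (x * X * y) + t 2 * (x * X + X * y + y * x)
  + t 3 * y + t 4 * x + t 5 * X + t 6.
Definition d2f (i : nat) x y : F := t 1 * (x * y) + t 2 * (x + y) + t i.
Definition hf x X : F :=
  d2f 3 x X * (t 3 * (x * X) + t 6 * (x + X) + t 7)
  - (t 2 * (x * X) + t 4 * X + t 5 * x + t 6)
    * (t 2 * (x * X) + t 4 * x + t 5 * X + t 6).
Definition dhf x X : F :=
  (t 1 * x + t 2) * (t 3 * (x * X) + t 6 * (x + X) + t 7)
  + d2f 3 x X * (t 3 * x + t 6)
  - (t 2 * x + t 4) * (t 2 * (x * X) + t 4 * x + t 5 * X + t 6)
  - (t 2 * (x * X) + t 4 * X + t 5 * x + t 6) * (t 2 * x + t 5).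

(** These symmetries make every first derivative of [Q] an instance of [Af]: those in [u01], [u10],
    [u00] are [Af X x Y], [Af y Y x], [Af Y y X]. They also let statements be reused on reversed
    rows. *)
Lemma Qf_swap_col x X y Y : Qf X x Y y = Qf x X y Y.
Proof. by rewrite /Qf; ring. Qed.
Lemma Qf_swap_row x X y Y : Qf y Y x X = Qf x X y Y.
Proof. by rewrite /Qf; ring. Qed.
Lemma Qf_affine x X y Y : Qf x X y Y = Qf x X y 0 + Af x X y * Y.
Proof. by rewrite /Qf /Af; ring. Qed.

Lemma hf_on_shell x X y Y : Qf x X y Y = 0 -> hf x X = - (Af x X y * Af X x Y).
Proof.
move=> q0; transitivity (Qf x X y Y * d2f 3 x X - Af x X y * Af X x Y).
  by rewrite /hf /d2f /Qf /Af; ring.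
by rewrite q0 mul0r sub0r.
Qed.

Lemma dhf_on_shell x X y Y : Qf x X y Y = 0 ->
  dhf x X = Af y Y x * d2f 3 x X - Af x X y * d2f 4 x Y - Af X x Y * d2f 5 x y.
Proof.
move=> q0.
transitivity (Qf x X y Y * (t 1 * x + t 2) + Af y Y x * d2f 3 x X - Af x X y * d2f 4 x Y - Af X x Y * d2f 5 x y).
  by rewrite /dhf /d2f /Qf /Af; ring.
by rewrite q0 mul0r add0r.
Qed.

Lemma hf_sym x X : hf x X = hf X x.
Proof. by rewrite /hf /d2f; ring. Qed.

(** [hf x0] is quadratic in its second argument, and for quadratics the trapezoidal rule is
    exact. *)
Lemma hf_chord x0 x X :
  2 * (hf x0 x - hf x0 X) = (dhf x0 x + dhf x0 X) * (x - X).
Proof. by rewrite /hf /dhf /d2f; ring. Qed.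

Definition gf x y : F :=
  d2f 5 x y * (t 5 * (x * y) + t 6 * (x + y) + t 7)
  - (t 2 * (x * y) + t 4 * y + t 3 * x + t 6)
    * (t 2 * (x * y) + t 4 * x + t 3 * y + t 6).

Lemma gf_sym x y : gf x y = gf y x.
Proof. by rewrite /gf /d2f; ring. Qed.

Lemma gf_on_shell x X y Y : Qf x X y Y = 0 -> gf x y = - (Af x X y * Af y Y x).
Proof.
move=> q0; transitivity (Qf x X y Y * d2f 5 x y - Af x X y * Af y Y x).
  by rewrite /gf /d2f /Qf /Af; ring.
by rewrite q0 mul0r sub0r.
Qed.

(** After a column swap both quadrilaterals start from the edge [(x, y)]. Subtracting the equations
    and moving one free corner at a time leaves one derivative per corner. *)
Lemma toric x' x X y' y Y : Qf x' x y' y = 0 -> Qf x X y Y = 0 ->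
  Af x x' y * (Y - y') = - (Af y Y x * (X - x')).
Proof.
move=> q1 q2; apply/eqP; rewrite -addr_eq0; apply/eqP.
transitivity (Qf x X y Y - Qf x' x y' y).
  by rewrite /Qf /Af; ring.
by rewrite q1 q2 subr0.
Qed.

Section Half.
Variables x0 x1 x2 y0 y1 y2 w W w1 W1 : F.
Let a := Af x0 x1 y0. Let b := Af x1 x0 y1. Let c := Af y0 y1 x0. Let d := Af y1 y0 x1.
Let b1 := Af x2 x1 y2. Let d1 := Af y2 y1 x2.
Hypotheses (q0 : Qf x0 x1 y0 y1 = 0) (q1 : Qf x1 x2 y1 y2 = 0).
Hypotheses (w1P : w1 * (x2 - x0) = 1) (W1P : W1 * (y2 - y0) = 1).
Hypothesis e0 : a * w + c * W = d2f 5 x0 y0.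

(** The contribution of the columns to the right of [(x0, y0)] to [K1_row_difference]. The
    right-hand side is free of [x2], [y2], [w1], [W1], so it can cancel against its mirror image. *)
Lemma K1_row_difference_half :
  w1 * W1 * (a * d1 - c * b1)
  - (2 * (hf x0 x1 * w) - dhf x0 x1) * w1 + (2 * (hf y0 y1 * W) - dhf y0 y1) * W1
  = a * (t 1 * y1 + t 2) - c * (t 1 * x1 + t 2) - (a * w - c * W) * d2f 5 x1 y1.
Proof.
have q0' : Qf y0 y1 x0 x1 = 0 by rewrite Qf_swap_row.
rewrite (dhf_on_shell q0) (dhf_on_shell q0') (hf_on_shell q0) (hf_on_shell q0').
rewrite -/a -/b -/c -/d.
(* At [x2 = x0], [y2 = y0] the factors [d1] and [b1] become [c] and [a], so this expansion in the
   two chords has no constant term. *)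
have Pd : a * d1 - c * b1 = (a * d2f 4 x0 y1 - c * d2f 3 x0 x1) * (y2 - y0)
   + (a * d2f 3 y0 y1 - c * d2f 4 x1 y0) * (x2 - x0)
   + (a * (t 1 * y1 + t 2) - c * (t 1 * x1 + t 2)) * ((x2 - x0) * (y2 - y0)).
  by rewrite /a /c /d1 /b1 /Af /d2f; ring.
(* The difference of the equations of two quadrilaterals sharing the edge [(x1, y1)]; divided by
   both chords it gives [d2f 5 x1 y1]. *)
have Fd : d * (x2 - x0) + b * (y2 - y0) + d2f 5 x1 y1 * ((x2 - x0) * (y2 - y0)) = 0.
  transitivity (Qf x1 x2 y1 y2 - Qf x0 x1 y0 y1); last by rewrite q0 q1 subr0.
  by rewrite /b /d /Qf /Af /d2f; ring.
have {}Fd : d * W1 + b * w1 + d2f 5 x1 y1 = 0.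
  transitivity (w1 * W1 * (d * (x2 - x0) + b * (y2 - y0) + d2f 5 x1 y1 * ((x2 - x0) * (y2 - y0)))); last by rewrite Fd mulr0.
  transitivity (d * W1 * (w1 * (x2 - x0)) + b * w1 * (W1 * (y2 - y0)) + d2f 5 x1 y1 * ((w1 * (x2 - x0)) * (W1 * (y2 - y0)))).
    by rewrite w1P W1P; ring.
  by ring.
have {}Pd : w1 * W1 * (a * d1 - c * b1) = (a * d2f 4 x0 y1 - c * d2f 3 x0 x1) * w1
   + (a * d2f 3 y0 y1 - c * d2f 4 x1 y0) * W1
   + (a * (t 1 * y1 + t 2) - c * (t 1 * x1 + t 2)).
  rewrite Pd.
  transitivity ((a * d2f 4 x0 y1 - c * d2f 3 x0 x1) * w1 * (W1 * (y2 - y0))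
   + (a * d2f 3 y0 y1 - c * d2f 4 x1 y0) * W1 * (w1 * (x2 - x0))
   + (a * (t 1 * y1 + t 2) - c * (t 1 * x1 + t 2)) * ((w1 * (x2 - x0)) * (W1 * (y2 - y0)))).
    by ring.
  by rewrite w1P W1P; ring.
rewrite Pd.
have -> : d2f 5 x1 y1 = - (d * W1 + b * w1).
  by apply/eqP; rewrite -addr_eq0 addrC; apply/eqP.
have E2 : d2f 5 y0 x0 = a * w + c * W by rewrite e0 /d2f; ring.
rewrite -e0 E2.
have -> : d2f 4 y0 x1 = d2f 4 x1 y0 by rewrite /d2f; ring.
by ring.
Qed.
End Half.

Lemma inv_chord (x X w : F) : w * (x - X) = 1 -> - w * (X - x) = 1.
Proof. by move=> <-; ring. Qed.

Lemma toric_inv x' x X y' y Y w W :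
  Qf x' x y' y = 0 -> Qf x X y Y = 0 ->
  w * (X - x') = 1 -> W * (Y - y') = 1 ->
  Af x x' y * w = - (Af y Y x * W).
Proof.
move=> q1 q2 wP WP; have := congr1 (fun z => w * W * z) (toric q1 q2) => /= E.
transitivity (Af x x' y * w * (W * (Y - y'))); first by rewrite WP mulr1.
transitivity (w * W * (Af x x' y * (Y - y'))); first by ring.
rewrite E; transitivity (- (Af y Y x * W * (w * (X - x')))); first by ring.
by rewrite wP mulr1.
Qed.

(** By [toric_inv] the second summand is [- Af x x' y * w], and [Af] is affine in its second
    argument with slope [d2f 5 x y]. *)
Lemma center_sum x' x X y' y Y w W :
  Qf x' x y' y = 0 -> Qf x X y Y = 0 ->
  w * (X - x') = 1 -> W * (Y - y') = 1 ->
  Af x X y * w + Af y Y x * W = d2f 5 x y.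
Proof.
move=> q1 q2 wP WP.
have := toric_inv q1 q2 wP WP => /eqP; rewrite -addr_eq0 => /eqP E.
transitivity (Af x X y * w + Af y Y x * W - (Af x x' y * w + Af y Y x * W)).
  by rewrite E subr0.
transitivity (d2f 5 x y * (w * (X - x'))); last by rewrite wP mulr1.
by rewrite /Af /d2f; ring.
Qed.

(** [2 K1] read off the edge to the right or to the left of [x], by [hf_chord]. This makes [K1] odd
    under reversal of the row. *)
Lemma two_forms x' x X w : w * (X - x') = 1 ->
  2 * (hf x X * w) - dhf x X = 2 * (hf x' x * w) + dhf x x'.
Proof.
move=> wP; apply/eqP; rewrite -subr_eq0; apply/eqP.
transitivity ((2 * (hf x X - hf x x')) * w - dhf x X - dhf x x').
  by rewrite (hf_sym x'); ring.
by rewrite hf_chord -mulrA (mulrC (X - _)) wP; ring.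
Qed.

Section Window.
Variables xm2 xm1 x0 x1 x2 ym2 ym1 y0 y1 y2 wm1 w0 w1 Wm1 W0 W1 : F.
Hypotheses (qm2 : Qf xm2 xm1 ym2 ym1 = 0) (qm1 : Qf xm1 x0 ym1 y0 = 0).
Hypotheses (q0 : Qf x0 x1 y0 y1 = 0) (q1 : Qf x1 x2 y1 y2 = 0).
Hypotheses (wm1P : wm1 * (x0 - xm2) = 1) (w0P : w0 * (x1 - xm1) = 1).
Hypotheses (w1P : w1 * (x2 - x0) = 1).
Hypotheses (Wm1P : Wm1 * (y0 - ym2) = 1) (W0P : W0 * (y1 - ym1) = 1).
Hypotheses (W1P : W1 * (y2 - y0) = 1).

(** The right half is added to its mirror image, in which every [w] changes sign. Once the
    derivatives at column 0 are expressed through [p] and [r], the two remainders cancel. *)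
Lemma K1_row_difference :
  w1 * W1 * (Af x0 x1 y0 * Af y2 y1 x2 - Af y0 y1 x0 * Af x2 x1 y2)
  + wm1 * Wm1 * (Af x0 xm1 y0 * Af ym2 ym1 xm2 - Af y0 ym1 x0 * Af xm2 xm1 ym2)
  - (2 * (hf x0 x1 * w0) - dhf x0 x1) * (w1 + wm1)
  + (2 * (hf y0 y1 * W0) - dhf y0 y1) * (W1 + Wm1) = 0.
Proof.
have C := center_sum qm1 q0 w0P W0P.
have R := K1_row_difference_half q0 q1 w1P W1P C.
have T1 := toric_inv qm1 q0 w0P W0P.
have T2 : Af x0 x1 y0 * w0 = - (Af y0 ym1 x0 * W0).
  have h0 := toric_inv (x' := x1) (x := x0) (X := xm1) (y' := y1) (y := y0) (Y := ym1) (w := - w0) (W := - W0).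
  have := h0 (etrans (Qf_swap_col _ _ _ _) q0) (etrans (Qf_swap_col _ _ _ _) qm1)
    (inv_chord w0P) (inv_chord W0P) => E.
  by apply: oppr_inj; rewrite -mulrN E mulrN.
have C' : Af x0 xm1 y0 * - w0 + Af y0 ym1 x0 * - W0 = d2f 5 x0 y0.
  by rewrite -C !mulrN T1 T2 opprK addrC.
have L := K1_row_difference_half (etrans (Qf_swap_col _ _ _ _) qm1)
  (etrans (Qf_swap_col _ _ _ _) qm2) (inv_chord wm1P) (inv_chord Wm1P) C'.
have K := two_forms x0 w0P; have KW := two_forms y0 W0P.
have EK : 2 * (hf x0 xm1 * - w0) - dhf x0 xm1 = - (2 * (hf x0 x1 * w0) - dhf x0 x1).
  by rewrite K (hf_sym x0); ring.
have EKW : 2 * (hf y0 ym1 * - W0) - dhf y0 ym1 = - (2 * (hf y0 y1 * W0) - dhf y0 y1).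
  by rewrite KW (hf_sym y0); ring.
move: R L; rewrite EK EKW.
set k := 2 * (hf x0 x1 * w0) - _; set l := 2 * (hf y0 y1 * W0) - _.
set A1 := Af x0 x1 y0 * _ - _; set A2 := Af x0 xm1 y0 * _ - _.
have ea : Af x0 x1 y0 = Af x0 x1 y0 * w0 * (x1 - xm1) by rewrite -mulrA w0P mulr1.
have ec : Af y0 y1 x0 = Af y0 y1 x0 * W0 * (y1 - ym1) by rewrite -mulrA W0P mulr1.
have eb : Af x0 xm1 y0 = - (Af y0 y1 x0 * W0) * (x1 - xm1).
  by rewrite -T1 -mulrA w0P mulr1.
have ed : Af y0 ym1 x0 = - (Af x0 x1 y0 * w0) * (y1 - ym1).
  by rewrite T2 opprK -mulrA W0P mulr1.
have er : Af x0 xm1 y0 * - w0 - Af y0 ym1 x0 * - W0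
    = - (Af x0 x1 y0 * w0 - Af y0 y1 x0 * W0).
  by rewrite !mulrN opprK T1 T2; ring.
rewrite {}er.
set p := Af x0 x1 y0 * w0 in ea ed *; set r := Af y0 y1 x0 * W0 in ec eb *.
rewrite {1}ea {1}ec {1}eb {1}ed => R L.
transitivity (w1 * W1 * A1 - k * w1 + l * W1
  + (- wm1 * - Wm1 * A2 - (- k) * (- wm1) + (- l) * (- Wm1))); first by ring.
by rewrite R L /d2f; ring.
Qed.

(** [center_sum] eliminates [w0] and [W0]. The right-hand side is invariant under reversal of the
    row while [2 K1] is odd, so the two halves of [K1_symmetry] cancel. *)
Lemma K1_half :
  Af y1 y0 x1 * (2 * (hf x0 x1 * w0) - dhf x0 x1)
  + Af x1 x0 y1 * (2 * (hf y0 y1 * W0) - dhf y0 y1)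
  = Af x0 x1 y0 * (Af y1 y0 x1 * d2f 4 x0 y1 - Af x1 x0 y1 * d2f 3 y0 y1)
    + Af y0 y1 x0 * (Af x1 x0 y1 * d2f 4 x1 y0 - Af y1 y0 x1 * d2f 3 x0 x1).
Proof.
have C := center_sum qm1 q0 w0P W0P.
have q0' : Qf y0 y1 x0 x1 = 0 by rewrite Qf_swap_row.
rewrite (dhf_on_shell q0) (dhf_on_shell q0') (hf_on_shell q0) (hf_on_shell q0').
have -> : d2f 5 y0 x0 = d2f 5 x0 y0 by rewrite /d2f; ring.
rewrite -C.
have -> : d2f 4 y0 x1 = d2f 4 x1 y0 by rewrite /d2f; ring.
by ring.
Qed.

(** [center_sum] accounts for [wm1] and [Wm1]. What remains is [Q] on columns -1 and 2, expanded
    about its zero on columns -1 and 0 and divided by the chords. *)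
Lemma K2_half :
  Af xm1 x0 ym1 * (w1 + wm1) + Af ym1 y0 xm1 * (W1 + Wm1)
  = w1 * W1 * Qf xm1 x2 ym1 y2.
Proof.
have C := center_sum qm2 qm1 wm1P Wm1P.
transitivity (Af xm1 x0 ym1 * w1 + Af ym1 y0 xm1 * W1 + (Af xm1 x0 ym1 * wm1 + Af ym1 y0 xm1 * Wm1)).
  by ring.
rewrite C.
transitivity (w1 * W1 * (Qf xm1 x2 ym1 y2 - Qf xm1 x0 ym1 y0)).
  transitivity (Af xm1 x0 ym1 * w1 * (W1 * (y2 - y0))
    + Af ym1 y0 xm1 * W1 * (w1 * (x2 - x0))
    + d2f 5 xm1 ym1 * (w1 * (x2 - x0)) * (W1 * (y2 - y0))).
    by rewrite w1P W1P; ring.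
  by rewrite /Af /d2f /Qf; ring.
by rewrite qm1 subr0.
Qed.
End Window.

Section Square.
Variables xm2 xm1 x0 x1 x2 x3 ym2 ym1 y0 y1 y2 y3 : F.
Variables wm1 w0 w1 w2 Wm1 W0 W1 W2 : F.
Hypotheses (qm2 : Qf xm2 xm1 ym2 ym1 = 0) (qm1 : Qf xm1 x0 ym1 y0 = 0).
Hypotheses (q0 : Qf x0 x1 y0 y1 = 0) (q1 : Qf x1 x2 y1 y2 = 0).
Hypothesis q2 : Qf x2 x3 y2 y3 = 0.
Hypotheses (wm1P : wm1 * (x0 - xm2) = 1) (w0P : w0 * (x1 - xm1) = 1).
Hypotheses (w1P : w1 * (x2 - x0) = 1) (w2P : w2 * (x3 - x1) = 1).
Hypotheses (Wm1P : Wm1 * (y0 - ym2) = 1) (W0P : W0 * (y1 - ym1) = 1).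
Hypotheses (W1P : W1 * (y2 - y0) = 1) (W2P : W2 * (y3 - y1) = 1).

Lemma K1_symmetry :
  Af y1 y0 x1 * (2 * (hf x0 x1 * w0) - dhf x0 x1)
  + Af x1 x0 y1 * (2 * (hf y0 y1 * W0) - dhf y0 y1)
  + Af y0 y1 x0 * (2 * (hf x1 x2 * w1) - dhf x1 x2)
  + Af x0 x1 y0 * (2 * (hf y1 y2 * W1) - dhf y1 y2) = 0.
Proof.
have L := K1_half qm1 q0 w0P W0P.
have s1 : Qf x2 x1 y2 y1 = 0 by rewrite Qf_swap_col.
have s0 : Qf x1 x0 y1 y0 = 0 by rewrite Qf_swap_col.
have R := K1_half s1 s0 (inv_chord w1P) (inv_chord W1P).
have E : 2 * (hf x1 x0 * - w1) - dhf x1 x0 = - (2 * (hf x1 x2 * w1) - dhf x1 x2).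
  by rewrite (two_forms x1 w1P) (hf_sym x1 x0); ring.
have E' : 2 * (hf y1 y0 * - W1) - dhf y1 y0 = - (2 * (hf y1 y2 * W1) - dhf y1 y2).
  by rewrite (two_forms y1 W1P) (hf_sym y1 y0); ring.
move: R; rewrite E E' => R.
rewrite -addrA L.
move/(congr1 -%R): R; rewrite opprD -!mulrN !opprK => ->.
by rewrite /d2f; ring.
Qed.

(** This is [D_Q(K2)] divided by the product of the derivatives in [u11] and [u01]. Both halves
    yield [Q] on columns -1 and 2, and [toric_inv] at columns 0 and 1 shows that they cancel. *)
Lemma K2_symmetry :
  Af y1 y0 x1 * Af x0 xm1 y0 * w0 ^+ 2
    * (Af xm1 x0 ym1 * (w1 + wm1) + Af ym1 y0 xm1 * (W1 + Wm1))
  + Af y0 y1 x0 * Af x1 x2 y1 * w1 ^+ 2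
    * (Af x2 x1 y2 * (w2 + w0) + Af y2 y1 x2 * (W2 + W0)) = 0.
Proof.
rewrite (K2_half qm2 qm1 wm1P w1P Wm1P W1P).
have s2 : Qf x3 x2 y3 y2 = 0 by rewrite Qf_swap_col.
have s1 : Qf x2 x1 y2 y1 = 0 by rewrite Qf_swap_col.
have R := K2_half s2 s1 (inv_chord w2P) (inv_chord w0P)
  (inv_chord W2P) (inv_chord W0P).
have E : Af x2 x1 y2 * (w2 + w0) + Af y2 y1 x2 * (W2 + W0)
    = - (w0 * W0 * Qf xm1 x2 ym1 y2).
  rewrite -(Qf_swap_col xm1) -(mulrNN w0) -R; ring.
rewrite E.
have T0 := toric_inv qm1 q0 w0P W0P.
have T1 := toric_inv (etrans (Qf_swap_col _ _ _ _) q1)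
  (etrans (Qf_swap_col _ _ _ _) q0) (inv_chord w1P) (inv_chord W1P).
transitivity (w0 * w1 * Qf xm1 x2 ym1 y2 *
  (Af y1 y0 x1 * W1 * (Af x0 xm1 y0 * w0) + Af y0 y1 x0 * W0 * (Af x1 x2 y1 * - w1))).
  by ring.
by rewrite T0 T1; ring.
Qed.
End Square.
End Polys.

Section Morph.
Variables (F E : fieldType) (f : {rmorphism F -> E}) (t : nat -> F) (t' : nat -> E).
Hypothesis ft : forall i, f (t i) = t' i.
Let fE := (rmorphB, rmorphD, rmorphM, ft).

Lemma rmorph_Qf x X y Y : f (Qf t x X y Y) = Qf t' (f x) (f X) (f y) (f Y).
Proof. by rewrite /Qf !fE. Qed.
Lemma rmorph_Af x X y : f (Af t x X y) = Af t' (f x) (f X) (f y).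
Proof. by rewrite /Af !fE. Qed.
Lemma rmorph_hf x X : f (hf t x X) = hf t' (f x) (f X).
Proof. by rewrite /hf /d2f !fE. Qed.
Lemma rmorph_dhf x X : f (dhf t x X) = dhf t' (f x) (f X).
Proof. by rewrite /dhf /d2f !fE. Qed.
Lemma rmorph_gf x X : f (gf t x X) = gf t' (f x) (f X).
Proof. by rewrite /gf /d2f !fE. Qed.
End Morph.

(** * The rational identity behind [D_Q(R(K)) = 0] *)

Section Core.
Variable F : fieldType.

(** The part of the operator without antiderivatives, in terms of derivatives of [Q]. The products
    [A0 Bm1 w0^2], [A1 B0 w1^2] and [Am1 Bm2 wm1^2] turn out to be the same on both rows, which
    makes the rows comparable. *)
Lemma row_form (Am2 Am1 A0 A1 Bm2 Bm1 B0 B1 wm1 w0 w1 k Km2 Km1 K0 K1 K2 hm2 hm1 h0 h1 : F) :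
  [&& Am1 != 0, A0 != 0, A1 != 0, Bm2 != 0, Bm1 != 0 & B0 != 0] ->
  hm2 = - (Am2 * Bm2) -> hm1 = - (Am1 * Bm1) -> h0 = - (A0 * B0) -> h1 = - (A1 * B1) ->
  h0 * hm1 * w0 ^+ 2 * (w1 ^+ 2 * K2 + wm1 ^+ 2 * Km2)
  + k * (h0 * hm1 * w0 ^+ 2 * (w1 + wm1)) * (K1 / h0 + Km1 / hm1)
  - w0 ^+ 2 * (hm1 * h1 * w1 ^+ 2 + hm2 * h0 * wm1 ^+ 2) * K0
  = A0 * Bm1 * w0 ^+ 2 *
    (Am1 / A1 * (A1 * B0 * w1 ^+ 2) * K2 + B0 / Bm2 * (Am1 * Bm2 * wm1 ^+ 2) * Km2
     - k * (w1 + wm1) * (Am1 / A0 * K1 + B0 / Bm1 * Km1)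
     - (Am1 * B1 / (A0 * B0) * (A1 * B0 * w1 ^+ 2)
        + Am2 * B0 / (Am1 * Bm1) * (Am1 * Bm2 * wm1 ^+ 2)) * K0).
Proof.
move=> /and5P[n1 n2 n3 n4 /andP[n5 n6]] -> -> -> ->.
by field; rewrite ?oppr_eq0 ?mulf_eq0 ?negb_or ?n1 ?n2 ?n3 ?n4 ?n5 ?n6.
Qed.

(** Columns -2 and -1 are eliminated by the linear equations on quadrilaterals -2 and -1 and by the
    row difference of [K1]; only [K0] and [X0] survive. *)
Lemma left_terms (am2 am1 a0 a1 bm2 bm1 b0 b1 cm2 cm1 c0 c1 dm2 dm1 d0 d1 : F)
   (mm1 m0 m1 k l s S Km2 Km1 K0 Xm2 Xm1 X0 : F) :
  [&& am1 != 0, a0 != 0, a1 != 0, bm2 != 0, bm1 != 0 & b0 != 0] ->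
  [&& cm1 != 0, c0 != 0, c1 != 0, dm2 != 0, dm1 != 0 & d0 != 0] ->
  dm2 = am1 * cm1 / bm2 -> dm1 = a0 * c0 / bm1 -> d0 = a1 * c1 / b0 ->
  - (m1 / (a1 * c1)) * (a0 * d1 - c0 * b1)
    - mm1 / (am1 * cm1) * (bm1 * cm2 - dm1 * am2) - k * s + l * S = 0 ->
  am2 * Xm1 + bm2 * Xm2 + cm2 * Km1 + dm2 * Km2 = 0 ->
  am1 * X0 + bm1 * Xm1 + cm1 * K0 + dm1 * Km1 = 0 ->
  m0 * (d0 * (b0 / bm2 * mm1 * Km2 - k * s * (b0 / bm1 * Km1))
        + b0 * (d0 / dm2 * mm1 * Xm2 - l * S * (d0 / dm1 * Xm1)))
  + m1 * (c0 * (b1 / bm1 * m0 * Km1) + a0 * (d1 / dm1 * m0 * Xm1))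
  = K0 * (b0 * d0 * am2 / (am1 * bm1) * m0 * mm1 - cm1 * d1 / c0 * m0 * m1
          + b0 * d0 * cm1 * m0 * l * S / (a0 * c0))
  + X0 * (b0 * d0 * cm2 / (cm1 * dm1) * m0 * mm1 - am1 * b1 / a0 * m0 * m1
          + b0 * d0 * am1 * m0 * k * s / (a0 * c0)).
Proof.
move=> /and5P[n1 n2 n3 n4 /andP[n5 n6]] /and5P[n7 n8 n9 n10 /andP[n11 n12]] E1 E2 E3 C0 L2 L1.
apply/eqP; rewrite -subr_eq0; apply/eqP.
(* The first multiplier is fixed by the coefficients of [Km2] and [Xm2], the second by that of
   [Km1]; what is then left at [Xm1] is a multiple of the row difference. *)
transitivity (b0 * d0 * m0 * mm1 / (am1 * cm1) * (am2 * Xm1 + bm2 * Xm2 + cm2 * Km1 + dm2 * Km2)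
 + (- (b0 * d0 * m0 * mm1 / (am1 * cm1)) * cm2 + m0 * m1 * c0 * b1 / bm1 - b0 * d0 * m0 * k * s / bm1) / dm1
   * (am1 * X0 + bm1 * Xm1 + cm1 * K0 + dm1 * Km1)
 - b0 * d0 * m0 * (Xm1 / dm1 + cm1 * K0 / (bm1 * dm1)) *
  (- (m1 / (a1 * c1)) * (a0 * d1 - c0 * b1)
    - mm1 / (am1 * cm1) * (bm1 * cm2 - dm1 * am2) - k * s + l * S)).
  rewrite E1 E2 E3; field.
  by rewrite ?n1 ?n2 ?n3 ?n4 ?n5 ?n6 ?n7 ?n8 ?n9.
by rewrite C0 L2 L1; ring.
Qed.

Section Assembly.
Variables am2 am1 a0 a1 a2 bm2 bm1 b0 b1 b2 : F.
Variables cm2 cm1 c0 c1 c2 dm2 dm1 d0 d1 d2 : F.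
Variables mm1 m0 m1 m2 k l k1 l1 s S s1 S1 : F.
Variables Km2 Km1 K0 K1 K2 K3 Xm2 Xm1 X0 X1 X2 X3 : F.
Hypotheses (am1N : am1 != 0) (a0N : a0 != 0) (a1N : a1 != 0) (a2N : a2 != 0).
Hypotheses (bm2N : bm2 != 0) (bm1N : bm1 != 0) (b0N : b0 != 0) (b1N : b1 != 0).
Hypotheses (cm1N : cm1 != 0) (c0N : c0 != 0) (c1N : c1 != 0) (c2N : c2 != 0).
Hypotheses (dm2N : dm2 != 0) (dm1N : dm1 != 0) (d0N : d0 != 0) (d1N : d1 != 0).
Hypotheses (gm1 : am1 * cm1 = bm2 * dm2) (g0 : a0 * c0 = bm1 * dm1).
Hypotheses (g1 : a1 * c1 = b0 * d0) (g2 : a2 * c2 = b1 * d1).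
Hypothesis C0 : - (m1 / (a1 * c1)) * (a0 * d1 - c0 * b1)
    - mm1 / (am1 * cm1) * (bm1 * cm2 - dm1 * am2) - k * s + l * S = 0.
Hypothesis C1 : - (m2 / (a2 * c2)) * (a1 * d2 - c1 * b2)
    - m0 / (a0 * c0) * (b0 * cm1 - d0 * am1) - k1 * s1 + l1 * S1 = 0.
Hypothesis symK1 : d0 * k + b0 * l + c0 * k1 + a0 * l1 = 0.
Hypothesis symK2 : b0 * d0 * m0 * (am1 * s + cm1 * S)
  + a0 * c0 * m1 * (b1 * s1 + d1 * S1) = 0.
Hypotheses (Lm2 : am2 * Xm1 + bm2 * Xm2 + cm2 * Km1 + dm2 * Km2 = 0).
Hypotheses (Lm1 : am1 * X0 + bm1 * Xm1 + cm1 * K0 + dm1 * Km1 = 0).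
Hypotheses (L0 : a0 * X1 + b0 * X0 + c0 * K1 + d0 * K0 = 0).
Hypotheses (L1 : a1 * X2 + b1 * X1 + c1 * K2 + d1 * K1 = 0).
Hypotheses (L2 : a2 * X3 + b2 * X2 + c2 * K3 + d2 * K2 = 0).
Let P := am1 * b0 * m0 * s.
Let N := cm1 * d0 * m0 * S.
Let P1 := a0 * b1 * m1 * s1.
Let N1 := c0 * d1 * m1 * S1.
Let r1 := - ((P * K1 - P1 * K0) / (a0 * b0)).
Let r2 := - ((k * K1 - k1 * K0) / (a0 * b0)).
Let s10 := - ((N * K0 - P * X0) / (a0 * c0)).
Let s20 := - ((l * K0 - k * X0) / (a0 * c0)).
Let s11 := - ((N1 * K1 - P1 * X1) / (b0 * d0)).
Let s21 := - ((l1 * K1 - k1 * X1) / (b0 * d0)).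

(** This is [left_terms] on the reversed row, where [a] and [b], and likewise [c] and [d], trade
    places. *)
Lemma right_terms :
  m1 * (c0 * (a0 / a2 * m2 * K3 - k1 * s1 * (a0 / a1 * K2))
        + a0 * (c0 / c2 * m2 * X3 - l1 * S1 * (c0 / c1 * X2)))
  + m0 * (d0 * (am1 / a1 * m1 * K2) + b0 * (cm1 / c1 * m1 * X2))
  = K1 * (a0 * c0 * b2 / (b1 * a1) * m1 * m2 - d1 * cm1 / d0 * m1 * m0
          + a0 * c0 * d1 * m1 * l1 * S1 / (b0 * d0))
  + X1 * (a0 * c0 * d2 / (d1 * c1) * m1 * m2 - b1 * am1 / b0 * m1 * m0
          + a0 * c0 * b1 * m1 * k1 * s1 / (b0 * d0)).
Proof.
have R := @left_terms b2 b1 b0 bm1 a2 a1 a0 am1 d2 d1 d0 dm1 c2 c1 c0 cm1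
  m2 m1 m0 k1 l1 s1 S1 K3 K2 K1 X3 X2 X1.
transitivity (m1 *
     (c0 * (a0 / a2 * m2 * K3 - k1 * s1 * (a0 / a1 * K2)) +
      a0 * (c0 / c2 * m2 * X3 - l1 * S1 * (c0 / c1 * X2))) +
     m0 * (d0 * (am1 / a1 * m1 * K2) + b0 * (cm1 / c1 * m1 * X2))).
  by ring.
rewrite R.
- by field; rewrite b1N a1N d0N d1N c1N b0N.
- by rewrite b1N b0N bm1N a2N a1N a0N.
- by rewrite d1N d0N dm1N c2N c1N c0N.
- by rewrite -g2 mulrC mulKf.
- by rewrite -g1 mulrC mulKf.
- by rewrite -g0 mulrC mulKf.
- by rewrite -g0 -g2 -{}C1; ring.
- by rewrite -{}L2; ring.
- by rewrite -{}L1; ring.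
Qed.

(** The antiderivatives enter only through their increments between corners: [r1], [r2] along the
    row, the others across rows. After both eliminations the sum is a multiple of the linear
    equation on the central square plus multiples of [D_Q(K1)] and [D_Q(K2)]. *)
Lemma recursion_identity :
  d0 * (m0 * (am1 / a1 * m1 * K2 + b0 / bm2 * mm1 * Km2
     - k * s * (am1 / a0 * K1 + b0 / bm1 * Km1)
     - (am1 * b1 / (a0 * b0) * m1 + am2 * b0 / (am1 * bm1) * mm1) * K0))
  + b0 * (m0 * (cm1 / c1 * m1 * X2 + d0 / dm2 * mm1 * Xm2
     - l * S * (cm1 / c0 * X1 + d0 / dm1 * Xm1)
     - (cm1 * d1 / (c0 * d0) * m1 + cm2 * d0 / (cm1 * dm1) * mm1) * X0))
  + c0 * (m1 * (a0 / a2 * m2 * K3 + b1 / bm1 * m0 * Km1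
     - k1 * s1 * (a0 / a1 * K2 + b1 / b0 * K0)
     - (a0 * b2 / (a1 * b1) * m2 + am1 * b1 / (a0 * b0) * m0) * K1))
  + a0 * (m1 * (c0 / c2 * m2 * X3 + d1 / dm1 * m0 * Xm1
     - l1 * S1 * (c0 / c1 * X2 + d1 / d0 * X0)
     - (c0 * d2 / (c1 * d1) * m2 + cm1 * d1 / (c0 * d0) * m0) * X1))
  + (b0 * (l * s10 + N * s20) + c0 * (k1 * r1 + P1 * r2)
     + a0 * (l1 * (r1 + s11) + N1 * (r2 + s21))) = 0.
Proof.
have SL : m0 * (d0 * (b0 / bm2 * mm1 * Km2 - k * s * (b0 / bm1 * Km1))
        + b0 * (d0 / dm2 * mm1 * Xm2 - l * S * (d0 / dm1 * Xm1)))
  + m1 * (c0 * (b1 / bm1 * m0 * Km1) + a0 * (d1 / dm1 * m0 * Xm1))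
  = K0 * (b0 * d0 * am2 / (am1 * bm1) * m0 * mm1 - cm1 * d1 / c0 * m0 * m1
          + b0 * d0 * cm1 * m0 * l * S / (a0 * c0))
  + X0 * (b0 * d0 * cm2 / (cm1 * dm1) * m0 * mm1 - am1 * b1 / a0 * m0 * m1
          + b0 * d0 * am1 * m0 * k * s / (a0 * c0)).
  apply: (@left_terms _ _ _ a1 _ _ _ _ _ _ _ c1) => //.
  - by rewrite am1N a0N a1N bm2N bm1N b0N.
  - by rewrite cm1N c0N c1N dm2N dm1N d0N.
  - by rewrite gm1 mulrC mulKf.
  - by rewrite g0 mulrC mulKf.
  - by rewrite g1 mulrC mulKf.
have SR := right_terms.
set V := b1 * s1 + d1 * S1.
pose kk := d0 * k + b0 * l + c0 * k1 + a0 * l1.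
pose G := b0 * d0 * m0 * (am1 * s + cm1 * S) + a0 * c0 * m1 * V.
pose B := (d0 * k + b0 * l) * G - kk * (a0 * c0 * m1 * V).
have B0 : B = 0 by rewrite /B /G symK2 /kk symK1; ring.
(* The coefficient of [K0] left by the eliminations; [e0 / d0] is therefore the multiple of the
   central linear equation. *)
pose e0 := - m0 * m1 * (cm1 * d1 / c0 + d0 * am1 * b1 / (a0 * b0))
  - b0 * d0 * cm1 * m0 * l * S / (a0 * c0)
  + m1 * ((c0 * k1 + a0 * l1) * b1 * s1 + c0 * d1 * S1 * k1) / b0.
transitivity (e0 / d0 * (a0 * X1 + b0 * X0 + c0 * K1 + d0 * K0)
  + B / (a0 * c0 * d0) * X0 + (B / d0 - kk * P - k * G) / (a0 * b0) * K1); last first.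
  by rewrite B0 L0 /G symK2 /kk symK1; ring.
move/eqP: SL; rewrite -subr_eq0 => /eqP SL; move/eqP: SR; rewrite -subr_eq0 => /eqP SR.
apply/eqP; rewrite -subr_eq0; apply/eqP.
transitivity (0 + 0 : F); last by rewrite addr0.
rewrite -{1}SL -SR.
rewrite /B /G /V /kk /e0 /r1 /r2 /s10 /s20 /s11 /s21 /P /N /P1 /N1.
field.
by rewrite a0N b0N c0N d0N am1N a1N a2N bm2N bm1N b1N cm1N c1N c2N dm2N dm1N d1N.
Qed.
End Assembly.
End Core.

(** * Sequences along two adjacent rows *)

Section Rows.
Variables (F : fieldType) (t : nat -> F).

(** Columns are natural numbers, so [n.-1] and [n.-2] are true neighbours only from [n = 2] on.
    [th1] and [th2] stand for antiderivatives of the densities of [m] and [k]. *)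
Definition recursion (h w k m K : nat -> F) (n : nat) (th1 th2 : F) : F :=
  h n * h n.-1 * w n ^+ 2
    * (w n.+1 ^+ 2 * K n.+2 + w n.-1 ^+ 2 * K n.-2)
  + k n * m n * (K n.+1 / h n + K n.-1 / h n.-1)
  - w n ^+ 2 * (h n.-1 * h n.+1 * w n.+1 ^+ 2 + h n.-2 * h n * w n.-1 ^+ 2) * K n
  + k n * th1 + m n * th2.

Definition row_h (x : nat -> F) n := hf t (x n) (x n.+1).
(* This is [2 K1]. *)
Definition row_k (x w : nat -> F) n :=
  2 * (row_h x n * w n) - dhf t (x n) (x n.+1).
Definition row_m (x w : nat -> F) n :=
  row_h x n * row_h x n.-1 * w n ^+ 2 * (w n.+1 + w n.-1).

Variables x y w W K X : nat -> F.
Let a n := Af t (x n) (x n.+1) (y n).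
Let b n := Af t (x n.+1) (x n) (y n.+1).
Let c n := Af t (y n) (y n.+1) (x n).
Let d n := Af t (y n.+1) (y n) (x n.+1).
Hypothesis Qn : forall n, Qf t (x n) (x n.+1) (y n) (y n.+1) = 0.
Hypotheses (aN : forall n, a n != 0) (bN : forall n, b n != 0).
Hypotheses (cN : forall n, c n != 0) (dN : forall n, d n != 0).
Hypothesis wP : forall n, w n.+1 * (x n.+2 - x n) = 1.
Hypothesis WP : forall n, W n.+1 * (y n.+2 - y n) = 1.
Hypothesis lin : forall n, d n * K n + b n * X n + c n * K n.+1 + a n * X n.+1 = 0.
Let h := row_h x.
Let H := row_h y.
Let k := row_k x w.
Let l := row_k y W.
Let m := row_m x w.
Let N := row_m y W.
(** Density and flux of [conservation_law] for the pair [f], [K]; in [row_flux], [g] continues [f]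
    to the upper row. *)
Definition row_density (f : nat -> F) n := (f n * K n.+1 - f n.+1 * K n) / row_h x n.
Definition row_flux (f g : nat -> F) n :=
  (g n * K n - X n * f n) / - (Af t (x n) (x n.+1) (y n) * Af t (y n) (y n.+1) (x n)).

Let Qc n : Qf t (x n.+1) (x n) (y n.+1) (y n) = 0.
Proof. by rewrite Qf_swap_col. Qed.
Let Qr n : Qf t (y n) (y n.+1) (x n) (x n.+1) = 0.
Proof. by rewrite Qf_swap_row. Qed.
Let hE n : h n = - (a n * b n).
Proof. exact: hf_on_shell. Qed.
Let HE n : H n = - (c n * d n).
Proof. exact: hf_on_shell (Qr n). Qed.
Let gE n : a n.+1 * c n.+1 = b n * d n.
Proof.
apply: oppr_inj; rewrite -(gf_on_shell (Qn n.+1)) (gf_on_shell (Qc n)) //.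
Qed.
Let torb n : b n * w n.+1 = - (c n.+1 * W n.+1).
Proof. exact: toric_inv (Qn n) (Qn n.+1) (wP n) (WP n). Qed.
Let tora n : a n.+1 * w n.+1 = - (d n * W n.+1).
Proof.
have := toric_inv (Qc n.+1) (Qc n) (inv_chord (wP n)) (inv_chord (WP n)).
by rewrite !mulrN => /oppr_inj.
Qed.
Let mu n := a n * b n.-1 * w n ^+ 2.
(** The weight [mu] can be computed from either row: multiply the two relations [torb] and
    [tora]. *)
Let muE n : c n.+1 * d n * W n.+1 ^+ 2 = mu n.+1.
Proof.
transitivity (- (c n.+1 * W n.+1) * - (d n * W n.+1)); first by ring.
by rewrite -torb -tora /mu /=; ring.
Qed.
Let wWE n : w n.+1 * W n.+1 = - (mu n.+1 / (a n.+1 * c n.+1)).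
Proof.
apply: (mulfI (mulf_neq0 (aN n.+1) (cN n.+1))).
transitivity (a n.+1 * w n.+1 * - - (c n.+1 * W n.+1)); first by ring.
rewrite -torb [RHS]mulrN [X in _ = - X]mulrC divfK ?mulf_neq0 //.
by rewrite /mu /=; ring.
Qed.

Let row_difference n : - (mu n.+3 / (a n.+3 * c n.+3)) * (a n.+2 * d n.+3 - c n.+2 * b n.+3)
  - mu n.+1 / (a n.+1 * c n.+1) * (b n.+1 * c n - d n.+1 * a n)
  - k n.+2 * (w n.+3 + w n.+1) + l n.+2 * (W n.+3 + W n.+1) = 0.
Proof.
have := K1_row_difference (Qn n) (Qn n.+1) (Qn n.+2) (Qn n.+3) (wP n) (wP n.+1) (wP n.+2)
  (WP n) (WP n.+1) (WP n.+2).
by rewrite !wWE => <-; rewrite /k /l /row_k /row_h /a /b /c /d; ring.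
Qed.

Let symk n : d n.+1 * k n.+1 + b n.+1 * l n.+1 + c n.+1 * k n.+2 + a n.+1 * l n.+2 = 0.
Proof. exact: K1_symmetry (Qn n) (Qn n.+1) (Qn n.+2) (wP n) (wP n.+1) (WP n) (WP n.+1). Qed.

Let mE n : m n.+2 = a n.+1 * b n.+2 * mu n.+2 * (w n.+3 + w n.+1).
Proof. by rewrite /m /row_m -/h /= !hE /mu /=; ring. Qed.
Let NE n : N n.+2 = c n.+1 * d n.+2 * mu n.+2 * (W n.+3 + W n.+1).
Proof. by rewrite /N /row_m -/H /= !HE -muE /=; ring. Qed.

Let symmu n : b n.+2 * d n.+2 * mu n.+2 * (a n.+1 * (w n.+3 + w n.+1) + c n.+1 * (W n.+3 + W n.+1))
  + a n.+2 * c n.+2 * mu n.+3 * (b n.+3 * (w n.+4 + w n.+2) + d n.+3 * (W n.+4 + W n.+2)) = 0.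
Proof.
have E := K2_symmetry (Qn n) (Qn n.+1) (Qn n.+2) (Qn n.+3) (Qn n.+4)
  (wP n) (wP n.+1) (wP n.+2) (wP n.+3) (WP n) (WP n.+1) (WP n.+2) (WP n.+3).
transitivity (a n.+2 * b n.+2 * 0); last by rewrite mulr0.
by rewrite -E /mu /= /a /b /c /d; ring.
Qed.

Lemma row_m_symmetry n :
  d n.+2 * m n.+2 + b n.+2 * N n.+2 + c n.+2 * m n.+3 + a n.+2 * N n.+3 = 0.
Proof. by rewrite !mE !NE -(symmu n); ring. Qed.
Lemma row_k_symmetry n :
  d n.+1 * k n.+1 + b n.+1 * l n.+1 + c n.+1 * k n.+2 + a n.+1 * l n.+2 = 0.
Proof. exact: symk. Qed.

(** The base values [th1] and [th2] come multiplied by [D_Q(2 K1)] and [D_Q(K2)], which vanish; the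
    increments are covered by [recursion_identity]. Columns 2 and 3 are the central square. *)
Lemma recursion_symmetry th1 th2 :
  d 2%N * recursion h w k m K 2%N th1 th2
  + b 2%N * recursion H W l N X 2%N (th1 + row_flux m N 2%N) (th2 + row_flux k l 2%N)
  + c 2%N * recursion h w k m K 3%N (th1 + row_density m 2%N) (th2 + row_density k 2%N)
  + a 2%N * recursion H W l N X 3%N (th1 + row_density m 2%N + row_flux m N 3%N)
      (th2 + row_density k 2%N + row_flux k l 3%N) = 0.
Proof.
have lin' n : a n * X n.+1 + b n * X n + c n * K n.+1 + d n * K n = 0.
  by rewrite -(lin n); ring.
have E := recursion_identity (aN 1%N) (aN 2%N) (aN 3%N) (aN 4%N) (bN 0%N) (bN 1%N) (bN 2%N) (bN 3%N)
  (cN 1%N) (cN 2%N) (cN 3%N) (cN 4%N) (dN 0%N) (dN 1%N) (dN 2%N) (dN 3%N)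
  (gE 0%N) (gE 1%N) (gE 2%N) (gE 3%N) (row_difference 0%N) (row_difference 1%N) (symk 1%N) (symmu 0%N)
  (lin' 0%N) (lin' 1%N) (lin' 2%N) (lin' 3%N) (lin' 4%N).
have local_x n : h n.+2 * h n.+1 * w n.+2 ^+ 2
    * (w n.+3 ^+ 2 * K n.+4 + w n.+1 ^+ 2 * K n)
  + k n.+2 * m n.+2 * (K n.+3 / h n.+2 + K n.+1 / h n.+1)
  - w n.+2 ^+ 2 * (h n.+1 * h n.+3 * w n.+3 ^+ 2 + h n * h n.+2 * w n.+1 ^+ 2) * K n.+2
  = mu n.+2 * (a n.+1 / a n.+3 * mu n.+3 * K n.+4 + b n.+2 / b n * mu n.+1 * K n
     - k n.+2 * (w n.+3 + w n.+1) * (a n.+1 / a n.+2 * K n.+3 + b n.+2 / b n.+1 * K n.+1)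
     - (a n.+1 * b n.+3 / (a n.+2 * b n.+2) * mu n.+3
        + a n * b n.+2 / (a n.+1 * b n.+1) * mu n.+1) * K n.+2).
  apply: row_form (hE n) (hE n.+1) (hE n.+2) (hE n.+3).
  by apply/and5P; split; [exact: aN|exact: aN|exact: aN|exact: bN|apply/andP; split; exact: bN].
have local_y n : H n.+2 * H n.+1 * W n.+2 ^+ 2
    * (W n.+3 ^+ 2 * X n.+4 + W n.+1 ^+ 2 * X n)
  + l n.+2 * N n.+2 * (X n.+3 / H n.+2 + X n.+1 / H n.+1)
  - W n.+2 ^+ 2 * (H n.+1 * H n.+3 * W n.+3 ^+ 2 + H n * H n.+2 * W n.+1 ^+ 2) * X n.+2
  = mu n.+2 * (c n.+1 / c n.+3 * mu n.+3 * X n.+4 + d n.+2 / d n * mu n.+1 * X n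
     - l n.+2 * (W n.+3 + W n.+1) * (c n.+1 / c n.+2 * X n.+3 + d n.+2 / d n.+1 * X n.+1)
     - (c n.+1 * d n.+3 / (c n.+2 * d n.+2) * mu n.+3
        + c n * d n.+2 / (c n.+1 * d n.+1) * mu n.+1) * X n.+2).
  rewrite -!muE; apply: row_form (HE n) (HE n.+1) (HE n.+2) (HE n.+3).
  by apply/and5P; split; [exact: cN|exact: cN|exact: cN|exact: dN|apply/andP; split; exact: dN].
have sk := row_k_symmetry 1%N; have sm := row_m_symmetry 0.
rewrite /recursion (local_x 0%N) (local_x 1%N) (local_y 0%N) (local_y 1%N).
transitivity (th1 * (d 2%N * k 2%N + b 2%N * l 2%N + c 2%N * k 3%N + a 2%N * l 3%N)
  + th2 * (d 2%N * m 2%N + b 2%N * N 2%N + c 2%N * m 3%N + a 2%N * N 3%N) + 0); last first.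
  by rewrite sk sm; ring.
have fluxE n f g : row_flux f g n = - ((g n * K n - X n * f n) / (a n * c n)).
  by rewrite /row_flux invrN mulrN.
have densE n f : row_density f n = - ((f n * K n.+1 - f n.+1 * K n) / (a n * b n)).
  by rewrite /row_density -/(h n) hE invrN mulrN.
rewrite -[X in _ = _ + X]E !densE !fluxE (gE 2%N).
rewrite (mE 0%N) (mE 1%N) (NE 0%N) (NE 1%N).
by ring.
Qed.
End Rows.

(** * Solutions with values in rational functions *)

Definition sg (e : bool) (p : int) : int := if e then - p else p.

Lemma sgK e : involutive (sg e).
Proof. by case: e => p //=; rewrite opprK. Qed.

Lemma sg_sg a b p : sg a (sg b p) = sg (a (+) b) p.
Proof. by case: a; case: b => //=; rewrite opprK. Qed.

(** Having the kernel of [proj], [psi] keeps admissible denominators nonzero and extends to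
    fractions; [phiE] is the independence of the chosen representation. *)
Lemma frac_lift (A : comNzRingType) (J : A -> Prop) (F E : fieldType)
    (proj : {rmorphism A -> F}) (psi : {rmorphism A -> E}) :
  is_frac_of_quotient J proj -> (forall a, psi a = 0 <-> proj a = 0) ->
  exists phi : {rmorphism F -> E}, forall a, phi (proj a) = psi a.
Proof.
move=> [_ fr] psi0.
have ex x : exists ab : A * A, (proj ab.2 != 0) && (x == proj ab.1 / proj ab.2).
  by have [a [b [nb ->]]] := fr x; exists (a, b); rewrite nb eqxx.
pose phi x := psi (xchoose (ex x)).1 / psi (xchoose (ex x)).2.
have psiN b : proj b != 0 -> psi b != 0.
  by apply: contra_neq => /psi0.
have phiE x a b : proj b != 0 -> x = proj a / proj b -> phi x = psi a / psi b.
  move=> nb xE; rewrite /phi; case: (xchoose _) (xchooseP (ex x)) => c d /=.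
  case/andP => nd /eqP; rewrite xE => /eqP.
  rewrite eqr_div // -!rmorphM -subr_eq0 -rmorphB => /eqP /psi0 /eqP.
  rewrite rmorphB subr_eq0 !rmorphM => /eqP e.
  by apply/eqP; rewrite eqr_div ?psiN // e.
have rep x : exists a b, proj b != 0 /\ x = proj a / proj b by apply: fr.
have phiB : zmod_morphism phi.
  move=> x y; have [a [b [nb xE]]] := rep x; have [c [d [nd yE]]] := rep y.
  rewrite (phiE _ _ _ nb xE) (phiE _ _ _ nd yE).
  rewrite (phiE (x - y) (a * d - c * b) (b * d)) ?rmorphM ?mulf_neq0 //.
    rewrite rmorphB !rmorphM; field; rewrite !psiN //.
  by rewrite xE yE rmorphB !rmorphM; field; rewrite nb nd.
have phiM : monoid_morphism phi.
  split; first by rewrite (phiE _ 1 1) !rmorph1 ?oner_neq0 ?divr1.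
  move=> x y; have [a [b [nb xE]]] := rep x; have [c [d [nd yE]]] := rep y.
  rewrite (phiE _ _ _ nb xE) (phiE _ _ _ nd yE).
  rewrite (phiE (x * y) (a * c) (b * d)) ?rmorphM ?mulf_neq0 //.
    by field; rewrite !psiN.
  by rewrite xE yE; field; rewrite nb nd.
pose f : {rmorphism F -> E} := HB.pack_for {rmorphism F -> E} phi
  (GRing.isZmodMorphism.Build F E phi phiB)
  (GRing.isMonoidMorphism.Build F E phi phiM).
by exists f => a; rewrite /= (phiE _ a 1) ?rmorph1 ?oner_neq0 ?divr1.
Qed.

(** * Values of rational functions at a point *)

Section Residue.
Variables (F E : fieldType) (inc : {rmorphism {poly F} -> E}).
Hypothesis inc_inj : injective inc.
Implicit Types (s r : F) (z : E) (p q : {poly F}).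

(** [z] is regular at [s] with value [r]; stated as a relation, for any field [E] receiving
    [{poly F}]. *)
Definition has_residue s z r :=
  exists p q, [/\ q.[s] != 0, z = (inc p) / (inc q) & r = p.[s] / q.[s]].

Lemma residue_poly s p : has_residue s (inc p) p.[s].
Proof.
by exists p, 1; rewrite hornerE rmorph1 !divr1 oner_neq0; split.
Qed.

Lemma residue_const s c : has_residue s (inc c%:P) c.
Proof. by rewrite -{2}(hornerC c s); apply: residue_poly. Qed.

Let inc_eq0 p : (inc p == 0) = (p == 0).
Proof. by rewrite -(inj_eq inc_inj) rmorph0. Qed.

Let incN q s : q.[s] != 0 -> (inc q) != 0 :> E.
Proof. by rewrite inc_eq0; apply: contra_neq => ->; rewrite horner0. Qed.

Lemma residueD s z1 z2 r1 r2 : has_residue s z1 r1 -> has_residue s z2 r2 ->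
  has_residue s (z1 + z2) (r1 + r2).
Proof.
move=> [p1 [q1 [n1 -> ->]]] [p2 [q2 [n2 -> ->]]].
exists (p1 * q2 + p2 * q1), (q1 * q2); split.
- by rewrite hornerM mulf_neq0.
- rewrite addf_div ?(incN n1) ?(incN n2) //.
  by rewrite rmorphD !rmorphM.
- by rewrite addf_div // !hornerE.
Qed.

Lemma residueM s z1 z2 r1 r2 : has_residue s z1 r1 -> has_residue s z2 r2 ->
  has_residue s (z1 * z2) (r1 * r2).
Proof.
move=> [p1 [q1 [n1 -> ->]]] [p2 [q2 [n2 -> ->]]].
exists (p1 * p2), (q1 * q2); split.
- by rewrite hornerM mulf_neq0.
- by rewrite mulf_div !rmorphM.
- by rewrite mulf_div !hornerE.
Qed.

Lemma residueN s z r : has_residue s z r -> has_residue s (- z) (- r).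
Proof.
move=> zr; rewrite -mulN1r -(mulN1r r); apply: residueM zr.
by have := residue_const s (- 1); rewrite !rmorphN !rmorph1.
Qed.

(** This carries nonvanishing from a specialization back to the rational functions. *)
Lemma residue_neq0 s z r : has_residue s z r -> r != 0 -> z != 0.
Proof.
move=> [p [q [nq -> ->]]]; apply: contra_neq.
move/eqP; rewrite mulf_eq0 invr_eq0 (negbTE (incN nq)) orbF inc_eq0.
by move/eqP ->; rewrite horner0 mul0r.
Qed.

Lemma residueV s z r : has_residue s z r -> r != 0 -> has_residue s z^-1 r^-1.
Proof.
move=> [p [q [nq -> ->]]] nr; exists q, p; split; rewrite ?invf_div //.
by apply: contra_neq nr => ->; rewrite mul0r.
Qed.
End Residue.

(** * The initial value problem on a quadrant *)

Section Grid.
Variables (E : fieldType) (t : nat -> E).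

Definition solve x X y : E := - Qf t x X y 0 / Af t x X y.

Lemma solveP x X y : Af t x X y != 0 -> Qf t x X y (solve x X y) = 0.
Proof.
by move=> nA; rewrite Qf_affine /solve mulrC divfK // subrr.
Qed.

Lemma solve_unique x X y Y : Af t x X y != 0 -> Qf t x X y Y = 0 ->
  Y = solve x X y.
Proof.
move=> nA; rewrite Qf_affine => /eqP; rewrite addr_eq0 => /eqP e.
by rewrite /solve e opprK mulrC mulKf.
Qed.

(* The solution on the quadrant N x N with prescribed values row i at (i, 0),
   i > 0, and col j at (0, j). *)
Fixpoint grid (row col : nat -> E) (i : nat) : nat -> E :=
  if i is i'.+1 then
    fix colj j := if j is j'.+1 then
        solve (grid row col i' j') (colj j') (grid row col i' j'.+1)
      else row i
  else col.

Lemma gridSS row col i j : grid row col i.+1 j.+1 =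
  solve (grid row col i j) (grid row col i.+1 j) (grid row col i j.+1).
Proof. by []. Qed.

Lemma grid_unique row col (V : nat -> nat -> E) :
  (forall i j, Qf t (V i j) (V i.+1 j) (V i j.+1) (V i.+1 j.+1) = 0) ->
  (forall i j, Af t (V i j) (V i.+1 j) (V i j.+1) != 0) ->
  (forall i, row i.+1 = V i.+1 0%N) -> (forall j, col j = V 0%N j) ->
  forall i j, grid row col i j = V i j.
Proof.
move=> VQ VA rowV colV; elim=> [|i IHi] j; first exact: colV.
elim: j => [|j IHj]; first exact: rowV.
by rewrite gridSS !IHi IHj -(solve_unique (VA i j) (VQ i j)).
Qed.
End Grid.

Section GridResidue.
Variables (F E : fieldType) (inc : {rmorphism {poly F} -> E}).
Hypothesis inc_inj : injective inc.
Variables (t : nat -> F) (s : F).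
Local Notation has_residue := (has_residue inc).
Let tE i : E := inc (t i)%:P.
Variables (row col : nat -> E) (V : nat -> nat -> F).
Hypothesis VQ : forall i j, Qf t (V i j) (V i.+1 j) (V i j.+1) (V i.+1 j.+1) = 0.
Hypothesis VA : forall i j, Af t (V i j) (V i.+1 j) (V i j.+1) != 0.
Hypothesis rowV : forall i, has_residue s (row i.+1) (V i.+1 0%N).
Hypothesis colV : forall j, has_residue s (col j) (V 0%N j).

Let tEs i : has_residue s (tE i) (t i). Proof. exact: residue_const. Qed.

Lemma residue_Af x X y rx rX ry : has_residue s x rx -> has_residue s X rX ->
  has_residue s y ry -> has_residue s (Af tE x X y) (Af t rx rX ry).
Proof. by move=> hx hX hy; do ![apply: residueD|apply: residueM|apply: residueN] => //. Qed.

Lemma residue_Qf x X y Y rx rX ry rY : has_residue s x rx -> has_residue s X rX ->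
  has_residue s y ry -> has_residue s Y rY ->
  has_residue s (Qf tE x X y Y) (Qf t rx rX ry rY).
Proof. by move=> hx hX hy hY; do ![apply: residueD|apply: residueM|apply: residueN] => //. Qed.

(** By induction the denominator of each [solve] specializes to a value of [Af] along [V], which is
    nonzero, so every entry stays regular at [s]. *)
Lemma grid_residue i j : has_residue s (grid tE row col i j) (V i j).
Proof.
elim: i j => [|i IHi] j; first exact: colV.
elim: j => [|j IHj]; first exact: rowV.
rewrite gridSS (solve_unique (VA i j) (VQ i j)) /solve.
have hA := residue_Af (IHi j) IHj (IHi j.+1).
apply: residueM; last exact: residueV (VA i j).
apply: residueN; apply: residue_Qf => //.
by have := residue_const inc s 0; rewrite !rmorph0.
Qed.

Lemma grid_solution i j : Qf tE (grid tE row col i j) (grid tE row col i.+1 j)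
  (grid tE row col i j.+1) (grid tE row col i.+1 j.+1) = 0.
Proof.
rewrite gridSS; apply: solveP; apply: (residue_neq0 inc_inj _ (VA i j)).
by apply: residue_Af; apply: grid_residue.
Qed.
End GridResidue.

(** * Mixed differences of symmetries *)

Lemma rmorph_dot4 (A B : fieldType) (g : {rmorphism A -> B}) a b c d a' b' c' d' :
  g (a * a' + b * b' + c * c' + d * d')
  = g a * g a' + g b * g b' + g c * g c' + g d * g d'.
Proof. by rewrite !rmorphD !rmorphM. Qed.

Section Mixed.
Variables (C F : fieldType) (cs : {rmorphism C -> F}).
Variables (t : nat -> F) (u : int -> int -> F) (sh : int -> int -> {rmorphism F -> F}).
Hypothesis sh_c : forall p q c, sh p q (cs c) = cs c.
Hypothesis sh_t : forall p q i, sh p q (t i) = t i.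
Hypothesis sh_u : forall p q i j, sh p q (u i j) = u (i + p) (j + q).
Hypothesis sh_sh : forall p q p' q' x, sh p q (sh p' q' x) = sh (p + p') (q + q') x.
Hypothesis sh0 : forall x, sh 0 0 x = x.
Hypothesis t_cs : forall i, exists c, t i = cs c.
Hypothesis finite_support : forall K, exists N : int,
  forall (E : fieldType) (f g : {rmorphism F -> E}),
  (forall c, f (cs c) = g (cs c)) ->
  (forall p q, p < N -> q < N -> f (u p q) = g (u p q)) -> f K = g K.

Definition cA := Af t (u 0 0) (u 1 0) (u 0 1).
Definition cB := Af t (u 1 0) (u 0 0) (u 1 1).
Definition cC := Af t (u 0 1) (u 1 1) (u 0 0).
Definition cD := Af t (u 1 1) (u 0 1) (u 1 0).
Definition sym K := cD * K + cB * sh 0 1 K + cC * sh 1 0 K + cA * sh 1 1 K = 0.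
Hypothesis cA_neq0 : cA != 0.

Section Quad.
Variable E : fieldType.
Implicit Types f : bool -> bool -> {rmorphism F -> E}.

Definition quad (i j : int) f :=
  [/\ forall s r s' r' c, f s r (cs c) = f s' r' (cs c),
      forall r p q, p < i -> f false r (u p q) = f true r (u p q)
    & forall s p q, q < j -> f s false (u p q) = f s true (u p q)].

Definition mix f K := f false false K - f true false K - f false true K + f true true K.

(** A negative shift enlarges the half-planes of agreement; this drives the induction of
    [mix_eq0]. *)
Lemma quad_sh i j i' j' a b f : quad i j f -> i' <= i - a -> j' <= j - b ->
  quad i' j' (fun s r => f s r \o sh a b)%FUN.
Proof.
move=> [fc fi fj] le_i le_j; split=> [s r s' r' c|r p q lt_p|s p q lt_q] /=.
- by rewrite sh_c; apply: fc.
- by rewrite sh_u; apply: fi; lia.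
- by rewrite sh_u; apply: fj; lia.
Qed.

(** Shifted by [S^-1 T^-1], the equation [D_Q K = 0] has coefficients in variables with indices -1
    and 0, where all four embeddings agree. So the mixed difference of [K] is a combination of those
    of three shifts of [K]. *)
Lemma mix_step i j f K : sym K -> 1 <= i -> 1 <= j -> quad i j f ->
  mix (fun s r => f s r \o sh (-1) 0)%FUN K = 0 ->
  mix (fun s r => f s r \o sh 0 (-1))%FUN K = 0 ->
  mix (fun s r => f s r \o sh (-1) (-1))%FUN K = 0 -> mix f K = 0.
Proof.
move=> sK le_i le_j [fc fi fj]; rewrite /mix /= => m10 m01 m11.
have fconst s r p q : p < i -> q < j -> f s r (u p q) = f false false (u p q).
  move=> lt_p lt_q; case: s; first rewrite -fi //; case: r => //; rewrite -fj //.
have fA s r x X y : f s r x = f false false x -> f s r X = f false false X ->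
    f s r y = f false false y -> f s r (Af t x X y) = f false false (Af t x X y).
  have ft k : f s r (t k) = f false false (t k) by have [c ->] := t_cs k; apply: fc.
  by move=> ex eX ey; rewrite (rmorph_Af ft) (rmorph_Af (fun=> erefl)) ex eX ey.
have fcoef s r (a b a' b' : bool) : forall a'' b'' : bool,
    f s r (sh (-1) (-1) (Af t (u a%:Z b%:Z) (u a'%:Z b'%:Z) (u a''%:Z b''%:Z)))
    = f false false (sh (-1) (-1) (Af t (u a%:Z b%:Z) (u a'%:Z b'%:Z) (u a''%:Z b''%:Z))).
  move=> a'' b''; rewrite (rmorph_Af (sh_t (-1) (-1))) !sh_u.
  by apply: fA; apply: fconst; lia.
have lin s r :
    f false false (sh (-1) (-1) cD) * f s r (sh (-1) (-1) K)
  + f false false (sh (-1) (-1) cB) * f s r (sh (-1) 0 K)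
  + f false false (sh (-1) (-1) cC) * f s r (sh 0 (-1) K)
  + f false false (sh (-1) (-1) cA) * f s r K = 0.
  rewrite -(fcoef s r true true false true true false).
  rewrite -(fcoef s r true false false false true true).
  rewrite -(fcoef s r false true true true false false).
  rewrite -(fcoef s r false false true false false true).
  have e0 : f s r (sh (-1) (-1) 0) = 0 by rewrite !rmorph0.
  by rewrite -[in LHS](sh0 K) -[RHS]e0 -[in RHS]sK (rmorph_dot4 (sh (-1) (-1))) rmorph_dot4 !sh_sh sh0.
have A0 : f false false (sh (-1) (-1) cA) != 0 by rewrite !fmorph_eq0.
apply: (mulfI A0); rewrite mulr0.
pose D := f false false (sh (-1) (-1) cD); pose B := f false false (sh (-1) (-1) cB).
pose G := f false false (sh (-1) (-1) cC).
have L00 := lin false false; have L10 := lin true false.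
have L01 := lin false true; have L11 := lin true true.
transitivity (0 - 0 - 0 + 0 - D * 0 - B * 0 - G * 0 : E); last by ring.
rewrite -{1}L00 -{1}L10 -{1}L01 -{1}L11 -{1}m11 -{1}m10 -{1}m01 /D /B /G.
by ring.
Qed.

Lemma mix_far K N i j f : (forall g h : {rmorphism F -> E},
  (forall c, g (cs c) = h (cs c)) ->
  (forall p q, p < N -> q < N -> g (u p q) = h (u p q)) -> g K = h K) ->
  quad i j f -> N <= i \/ N <= j -> mix f K = 0.
Proof.
move=> NP [fc fi fj] [le_N|le_N]; rewrite /mix.
  have e r : f false r K = f true r K.
    by apply: NP => [c|p q lt_p _]; [apply: fc | apply: fi; lia].
  by rewrite !e; ring.
have e s : f s false K = f s true K.
  by apply: NP => [c|p q _ lt_q]; [apply: fc | apply: fj; lia].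
by rewrite !e; ring.
Qed.

(* Downward induction: for [i] or [j] beyond the support of [K] two of the four
   values cancel the other two. *)
Lemma mix_eq0 K : sym K -> forall f, quad 1 1 f -> mix f K = 0.
Proof.
move=> sK; have [N NP] := finite_support K.
have H k i j f : 1 <= i -> 1 <= j -> (N - i) + (N - j) <= k%:Z ->
    quad i j f -> mix f K = 0; last by move=> f; apply: (H (absz (N + N)) 1 1); lia.
elim: k i j f => [|k IH] i j f le_i le_j le_k q'.
  by apply: (mix_far (NP E) q'); lia.
have [far|near] : (N <= i \/ N <= j) \/ (i < N /\ j < N) by lia.
  exact: mix_far (NP E) q' far.
apply: (mix_step sK le_i le_j q').
- by apply: (IH (i + 1) j); [lia | lia | lia | apply: quad_sh q' _ _; lia].
- by apply: (IH i (j + 1)); [lia | lia | lia | apply: quad_sh q' _ _; lia].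
- by apply: (IH (i + 1) (j + 1)); [lia | lia | lia | apply: quad_sh q' _ _; lia].
Qed.
End Quad.

Hypothesis two_neq0 : 2 != 0 :> F.
Hypothesis three_neq0 : 3 != 0 :> F.
Hypothesis u_square_A : forall p q (a b : bool),
  Af t (u (p + a%:Z) (q + b%:Z)) (u (p + (~~ a)%:Z) (q + b%:Z))
    (u (p + a%:Z) (q + (~~ b)%:Z)) != 0.
Hypothesis u_sg_Q : forall e d p q,
  Qf t (u (sg e p) (sg d q)) (u (sg e (p + 1)) (sg d q))
  (u (sg e p) (sg d (q + 1))) (u (sg e (p + 1)) (sg d (q + 1))) = 0.
Hypothesis F_hom_ext : forall (E : fieldType) (f g : {rmorphism F -> E}),
  (forall c, f (cs c) = g (cs c)) -> (forall p q, f (u p q) = g (u p q)) ->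
  f =1 g.
Variable rf : bool -> bool -> {rmorphism F -> F}.
Hypothesis rf_c : forall e d c, rf e d (cs c) = cs c.
Hypothesis rf_u : forall e d p q, rf e d (u p q) = u (sg e p) (sg d q).
Hypothesis lift_solution : forall (E : fieldType) (inc : {rmorphism {poly F} -> E}) s e d
    (U : int -> int -> E), injective inc ->
  (forall p q, Qf (fun i => inc (t i)%:P) (U p q) (U (p + 1) q) (U p (q + 1)) (U (p + 1) (q + 1)) = 0) ->
  (forall p q, has_residue inc s (U p q) (u (sg e p) (sg d q))) ->
  exists f : {rmorphism F -> E},
  (forall c, f (cs c) = inc (cs c)%:P) /\ (forall p q, f (u p q) = U p q).

Lemma u_sg_A e d p q :
  Af t (u (sg e p) (sg d q)) (u (sg e (p + 1)) (sg d q)) (u (sg e p) (sg d (q + 1))) != 0.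
Proof.
have := u_square_A (if e then - (p + 1) else p) (if d then - (q + 1) else q) e d.
have E1 r : - (r + 1) + 1 = - r :> int by ring.
by case: e; case: d; rewrite /= ?addr0 ?E1.
Qed.

(** * Solutions on the whole lattice from data on the two axes *)

Section Cross.
Variables (E : fieldType) (inc : {rmorphism {poly F} -> E}).
Hypothesis inc_inj : injective inc.
Let tE i := inc (t i)%:P.

(** [grid] fills each quadrant from its two half-axes. The origin is read from the vertical data,
    hence the hypothesis [C0] below. *)
Definition cross (Rm Rp Cm Cp : nat -> E) (p q : int) : E :=
  grid tE (if 0 <= p then Rp else Rm) (if 0 <= q then Cp else Cm) `|p| `|q|.

Section CrossData.
Variables Rm Rp Cm Cp : nat -> E.
Hypothesis C0 : Cm 0%N = Cp 0%N.

(** A point on an axis lies in two quadrants. Both descriptions agree, since there [grid] reads only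
    the data of that axis; at the origin [C0] is needed. *)
Lemma cross_quad (a b : bool) (i j : nat) : cross Rm Rp Cm Cp (sg a i) (sg b j)
  = grid tE (if a then Rm else Rp) (if b then Cm else Cp) i j.
Proof.
rewrite /cross.
have -> : `|sg a i|%N = i by case: a => /=; rewrite ?abszN ?absz_nat.
have -> : `|sg b j|%N = j by case: b => /=; rewrite ?abszN ?absz_nat.
have sgS c (k : nat) : (0 <= sg c k.+1) = ~~ c by case: c.
case: i => [|i]; case: j => [|j].
- by case: b; rewrite /= ?oppr0.
- by rewrite /= sgS if_neg.
- by rewrite sgS if_neg.
- by rewrite !sgS !if_neg.
Qed.

Variables (s : F) (e d : bool).
Hypothesis resR : forall i : nat, has_residue inc s (Rp i.+1) (u (sg e i.+1) 0).
Hypothesis resL : forall i : nat, has_residue inc s (Rm i.+1) (u (sg e (sg true i.+1)) 0).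
Hypothesis resU : forall j : nat, has_residue inc s (Cp j) (u 0 (sg d j)).
Hypothesis resD : forall j : nat, has_residue inc s (Cm j) (u 0 (sg d (sg true j))).

Let V (a b : bool) (i j : nat) := u (sg (e (+) a) i) (sg (d (+) b) j).
Let intS1 (i : nat) : i.+1%:Z = i%:Z + 1. Proof. by lia. Qed.

Let VQ a b i j : Qf t (V a b i j) (V a b i.+1 j) (V a b i j.+1) (V a b i.+1 j.+1) = 0.
Proof. by rewrite /V !intS1; apply: u_sg_Q. Qed.
Let VA a b i j : Af t (V a b i j) (V a b i.+1 j) (V a b i j.+1) != 0.
Proof. by rewrite /V !intS1; apply: u_sg_A. Qed.
Let sg0 a : sg a 0 = 0. Proof. by case: a; rewrite /= ?oppr0. Qed.
Let VR a b i : has_residue inc s ((if a then Rm else Rp) i.+1) (V a b i.+1 0).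
Proof.
rewrite /V sg0; case: a; last by rewrite addbF; apply: resR.
by rewrite -sg_sg; apply: resL.
Qed.
Let VC a b j : has_residue inc s ((if b then Cm else Cp) j) (V a b 0 j).
Proof.
rewrite /V sg0; case: b; last by rewrite addbF; apply: resU.
by rewrite -sg_sg; apply: resD.
Qed.

Lemma sgP (p : int) : exists a (i : nat), p = sg a i.
Proof. by case: (intP p) => [|i|i]; [exists false, 0%N | exists false, i.+1 | exists true, i.+1]. Qed.

Lemma cross_residue p q :
  has_residue inc s (cross Rm Rp Cm Cp p q) (u (sg e p) (sg d q)).
Proof.
have [a [i ->]] := sgP p; have [b [j ->]] := sgP q.
rewrite cross_quad !sg_sg; exact: (grid_residue inc_inj (VQ a b) (VA a b) (VR a b) (VC a b)).
Qed.

(** A unit step never straddles the origin; on the negative side its ends appear in reversed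
    order. *)
Lemma sg_stepP (p : int) : exists a (i : nat), p = sg a (i + a)%N /\ p + 1 = sg a (i + ~~ a)%N.
Proof.
case: (ltP p 0) => hp; [exists true, (absz (p + 1)) | exists false, (absz p)]; rewrite /=; lia.
Qed.

Lemma cross_solution p q : let U := cross Rm Rp Cm Cp in
  Qf tE (U p q) (U (p + 1) q) (U p (q + 1)) (U (p + 1) (q + 1)) = 0.
Proof.
have [a [i [-> ->]]] := sg_stepP p; have [b [j [-> ->]]] := sg_stepP q.
rewrite /= !cross_quad.
have := grid_solution inc_inj (VQ a b) (VA a b) (VR a b) (VC a b) i j.
by case: a; case: b; rewrite !addn0 !addn1 => H; rewrite -?H /Qf /tE; ring.
Qed.

Lemma cross_lift : exists f : {rmorphism F -> E},
  (forall c, f (cs c) = inc (cs c)%:P) /\ (forall p q, f (u p q) = cross Rm Rp Cm Cp p q).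
Proof. exact: lift_solution inc_inj cross_solution cross_residue. Qed.
End CrossData.
End Cross.

Lemma rf_sh e d p q x : rf e d (sh p q x) = sh (sg e p) (sg d q) (rf e d x).
Proof.
rewrite -[LHS]/((rf e d \o sh p q)%FUN x) -[RHS]/((sh (sg e p) (sg d q) \o rf e d)%FUN x).
apply: F_hom_ext => [c|i j] /=.
  have -> : sh p q (cs c) = cs c by exact: sh_c.
  by have -> : rf e d (cs c) = cs c; [exact: rf_c | rewrite sh_c].
have -> : sh p q (u i j) = u (i + p) (j + q) by exact: sh_u.
have -> : rf e d (u i j) = u (sg e i) (sg d j) by exact: rf_u.
by rewrite rf_u sh_u; case: e; case: d => /=; rewrite ?opprD.
Qed.

Lemma rf_rf e d x : rf e d (rf e d x) = x.
Proof.
rewrite -[LHS]/((rf e d \o rf e d)%FUN x) -[RHS]/(idfun x).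
apply: F_hom_ext => [c|i j] /=; first by rewrite !rf_c.
by rewrite !rf_u !sgK.
Qed.

Lemma rf_t e d i : rf e d (t i) = t i.
Proof. by have [c ->] := t_cs i. Qed.

(** The shift by [(p0, q0)] compensates the displacement of the basic square under the reflection,
    so the four terms of the equation are merely permuted. *)
Lemma sym_rf e d K : sym K -> sym (rf e d K).
Proof.
move=> sK; pose p0 := - (e%:Z); pose q0 := - (d%:Z).
have z0 : rf e d (sh p0 q0 0) = 0 by rewrite !rmorph0.
have E0 : rf e d (sh p0 q0 cD) * rf e d (sh p0 q0 K)
  + rf e d (sh p0 q0 cB) * rf e d (sh p0 q0 (sh 0 1 K))
  + rf e d (sh p0 q0 cC) * rf e d (sh p0 q0 (sh 1 0 K))
  + rf e d (sh p0 q0 cA) * rf e d (sh p0 q0 (sh 1 1 K)) = 0.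
  by rewrite -[RHS]z0 -[in RHS]sK (rmorph_dot4 (sh p0 q0)) rmorph_dot4.
have coef i1 j1 i2 j2 i3 j3 : rf e d (sh p0 q0 (Af t (u i1 j1) (u i2 j2) (u i3 j3))) =
    Af t (u (sg e (i1 + p0)) (sg d (j1 + q0))) (u (sg e (i2 + p0)) (sg d (j2 + q0)))
     (u (sg e (i3 + p0)) (sg d (j3 + q0))).
  by rewrite (rmorph_Af (sh_t p0 q0)) (rmorph_Af (rf_t e d)) !sh_u !rf_u.
move: E0; rewrite {1}/cD {1}/cB {1}/cC {1}/cA !coef !sh_sh !rf_sh /p0 /q0 /sym.
case: e {coef z0 p0}; case: d {q0}; rewrite /= ?addr0 ?add0r ?oppr0 ?subrr ?opprK ?sub0r ?opprK ?sh0 -/cA -/cB -/cC -/cD.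
- have perm (x y z v : F) : x + y + z + v = v + z + y + x by ring.
  by move=> h; apply: etrans (perm _ _ _ _) h.
- have perm (x y z v : F) : x + y + z + v = z + v + x + y by ring.
  by move=> h; apply: etrans (perm _ _ _ _) h.
- have perm (x y z v : F) : x + y + z + v = y + x + v + z by ring.
  by move=> h; apply: etrans (perm _ _ _ _) h.
- by [].
Qed.

(** * A chain of embeddings from the identity to the reflections *)

Section Configurations.
Variables (E : fieldType) (inc : {rmorphism {poly F} -> E}).
Hypothesis inc_inj : injective inc.
Let tE i := inc (t i)%:P.

Section Axis.
Variables (pol : {poly F}) (g : int -> F).

(* The pairs (left half, right half) are, for A = 0, 1, 2, 3, equal to (l, r),
   (l, f), (r, f), (r, l), where r i = g i, l i = g (- i) and f interpolates
   between r and l.  Consecutive pairs share a half; the last pair is the mirror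
   image of the first. *)
Definition cfg_right (A : nat) (i : nat) : E :=
  match A with
  | 0%N => inc (g i)%:P
  | 3%N => inc (g (sg true i))%:P
  | _ => inc ((g i)%:P + pol * (g (sg true i) - g i)%:P)
  end.
Definition cfg_left (A : nat) (i : nat) : E :=
  if (1 < A)%N then inc (g i)%:P else inc (g (sg true i))%:P.

(** Configurations 0 and 1 specialize to the generic half-axis, where [pol] is 0; configurations 2
    and 3 specialize to the reflected one, where [pol] is 1. *)
Lemma cfg_right_residue A s i : (A < 4)%N -> pol.[s] = (1 < A)%N%:R ->
  has_residue inc s (cfg_right A i) (g (sg (1 < A)%N i)).
Proof.
case: A => [|[|[|[|A]]]] //= _ ps; try exact: residue_const.
- rewrite [X in has_residue _ _ _ X](_ : _ = ((g i)%:P + pol * (g (- i%:Z) - g i)%:P).[s]); first exact: residue_poly.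
  by rewrite !hornerE ps mul0r addr0.
- rewrite [X in has_residue _ _ _ X](_ : _ = ((g i)%:P + pol * (g (- i%:Z) - g i)%:P).[s]); first exact: residue_poly.
  by rewrite !hornerE ps mul1r addrC subrK.
Qed.

Lemma cfg_left_residue A s i :
  has_residue inc s (cfg_left A i) (g (sg (1 < A)%N (sg true i))).
Proof.
rewrite /cfg_left sg_sg; case: ifP => _ /=; exact: residue_const.
Qed.

Lemma cfg_center A : cfg_left A 0 = cfg_right A 0.
Proof.
rewrite /cfg_left /cfg_right /= oppr0 subrr mulr0 addr0.
by case: A => [|[|[|[|A]]]].
Qed.

(** Only the step from 1 to 2 keeps the right half; the other two keep the left half. *)
Lemma cfg_step A : (A < 3)%N ->
  (if (A == 1)%N (+) true then cfg_left A else cfg_right A)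
  = (if (A == 1)%N (+) true then cfg_left A.+1 else cfg_right A.+1).
Proof. by case: A => [|[|[|A]]]. Qed.
End Axis.

Variables phi psi : {poly F}.
Variable pt : bool -> bool -> F.
Hypothesis phiE : forall e d, phi.[pt e d] = e%:R.
Hypothesis psiE : forall e d, psi.[pt e d] = d%:R.
Let row p := u p 0.
Let col q := u 0 q.

Definition cfg_spec (A B : nat) (f : {rmorphism F -> E}) :=
  (forall c, f (cs c) = inc (cs c)%:P) /\
  forall p q, f (u p q) = cross inc (cfg_left row A) (cfg_right phi row A)
    (cfg_left col B) (cfg_right psi col B) p q.

(** One indeterminate serves both axes: [pt] chooses independently on each of them between the
    generic and the reflected specialization. *)
Lemma cfg_exists A B : (A < 4)%N -> (B < 4)%N -> exists f, cfg_spec A B f.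
Proof.
move=> A4 B4; apply: (@cross_lift E inc inc_inj _ _ _ _ _ (pt (1 < A)%N (1 < B)%N) (1 < A)%N (1 < B)%N).
- exact: cfg_center.
- by move=> i; apply: (@cfg_right_residue phi row); rewrite ?phiE.
- by move=> i; apply: (@cfg_left_residue row).
- by move=> i; apply: (@cfg_right_residue psi col); rewrite ?psiE.
- by move=> i; apply: (@cfg_left_residue col).
Qed.

(** Where the shared half is the right or upper one, a reflection turns it into the half-plane
    required by [quad]; [K] is replaced by its reflection, again a symmetry. *)
Lemma cfg_adjacent A B K (f : bool -> bool -> {rmorphism F -> E}) :
  (A < 3)%N -> (B < 3)%N -> sym K ->
  (forall s r : bool, cfg_spec (A + s)%N (B + r)%N (f s r)) -> mix f K = 0.
Proof.
move=> A3 B3 sK fP.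
pose e := (A == 1)%N; pose d := (B == 1)%N.
have q1 : quad 1 1 (fun s r => f s r \o rf e d)%FUN.
  split=> [s r s' r' c|r p q lt_p|s p q lt_q] /=.
  - by rewrite rf_c !(fP _ _).1.
  - rewrite rf_u !(fP _ _).2.
    have [i ->] : exists i : nat, p = sg true i by exists (absz p); rewrite /=; lia.
    have [b [j ->]] := sgP q; rewrite !sg_sg !(cross_quad _ _ _ (cfg_center _ _ _)).
    by rewrite addn0 addn1 (cfg_step _ _ A3).
  - rewrite rf_u !(fP _ _).2.
    have [j ->] : exists j : nat, q = sg true j by exists (absz q); rewrite /=; lia.
    have [b [i ->]] := sgP p; rewrite !sg_sg !(cross_quad _ _ _ (cfg_center _ _ _)).
    by rewrite addn0 addn1 (cfg_step _ _ B3).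
have := mix_eq0 (sym_rf e d sK) q1.
by rewrite /mix /= !rf_rf.
Qed.

(** At a corner of the table the axis data are those of a reflected generic solution, and
    [grid_unique] extends the equality to every quadrant. *)
Lemma cfg_corner (e d : bool) f : cfg_spec (if e then 3 else 0) (if d then 3 else 0) f ->
  forall x, f x = inc (rf e d x)%:P.
Proof.
move=> [fc fu] x; pose iF : {rmorphism F -> E} := (inc \o polyC)%FUN.
have iFt i : iF (t i) = tE i by [].
rewrite -[RHS]/((iF \o rf e d)%FUN x); apply: F_hom_ext => [c|p q] /=.
  by rewrite rf_c; apply: fc.
rewrite fu rf_u; have [a [i ->]] := sgP p; have [b [j ->]] := sgP q.
rewrite (cross_quad _ _ _ (cfg_center _ _ _)) !sg_sg.
pose V (i j : nat) := iF (u (sg (e (+) a) i) (sg (d (+) b) j)).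
have intS1 (k : nat) : k.+1%:Z = k%:Z + 1 by lia.
have sg0 c : sg c 0%N = 0 by case: c; rewrite /= ?oppr0.
rewrite -[RHS]/(V i j); apply: grid_unique => [{}i {}j|{}i {}j|{}i|{}j]; rewrite /V ?sg0.
- by rewrite -(rmorph_Qf iFt) !intS1 u_sg_Q rmorph0.
- by rewrite -(rmorph_Af iFt) fmorph_eq0 !intS1; apply: u_sg_A.
- by case: (a); case: (e).
- by case: (b); case: (d).
Qed.

(** The nine unit squares of the 4 by 4 table of values telescope to its corners, which [cfg_corner]
    identifies. *)
Lemma reflection_mixed K : sym K ->
  K - rf true false K - rf false true K + rf true true K = 0.
Proof.
move=> sK.
have [f fP] := fin_all_exists
  (fun x : 'I_4 * 'I_4 => cfg_exists (ltn_ord x.1) (ltn_ord x.2)).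
pose n (a b : nat) := f (inord a, inord b) K.
have adj a b : (a < 3)%N -> (b < 3)%N -> n a b - n a.+1 b - n a b.+1 + n a.+1 b.+1 = 0.
  move=> a3 b3.
  have := @cfg_adjacent a b K (fun s r => f (inord (a + s), inord (b + r))) a3 b3 sK _.
  rewrite /mix /n !addn0 !addn1; apply => s r.
  have := fP (inord (a + s), inord (b + r)); rewrite /= !inordK //.
  - by case: (r); rewrite ?addn1 ?addn0 // ltnW.
  - by case: (s); rewrite ?addn1 ?addn0 // ltnW.
have c e d : n (if e then 3 else 0) (if d then 3 else 0) = inc (rf e d K)%:P.
  by apply: (@cfg_corner e d); have := fP (inord (if e then 3 else 0), inord (if d then 3 else 0)); rewrite /= !inordK //; [case: (d)|case: (e)].
apply: (@polyC_inj F); apply: inc_inj; rewrite !rmorph0.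
rewrite !(rmorphD, rmorphN) /=.
have rf00 : rf false false K = K.
  rewrite -[RHS]/(idfun K); apply: F_hom_ext => [k|p q] /=; [exact: rf_c|exact: rf_u].
rewrite -{1}rf00 -!c /=.
transitivity ((n 0%N 0%N - n 1%N 0%N - n 0%N 1%N + n 1%N 1%N) + (n 1%N 0%N - n 2%N 0%N - n 1%N 1%N + n 2%N 1%N)
  + (n 2%N 0%N - n 3%N 0%N - n 2%N 1%N + n 3%N 1%N)
  + ((n 0%N 1%N - n 1%N 1%N - n 0%N 2%N + n 1%N 2%N) + (n 1%N 1%N - n 2%N 1%N - n 1%N 2%N + n 2%N 2%N)
  + (n 2%N 1%N - n 3%N 1%N - n 2%N 2%N + n 3%N 2%N))
  + ((n 0%N 2%N - n 1%N 2%N - n 0%N 3%N + n 1%N 3%N) + (n 1%N 2%N - n 2%N 2%N - n 1%N 3%N + n 2%N 3%N)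
  + (n 2%N 2%N - n 3%N 2%N - n 2%N 3%N + n 3%N 3%N))).
  by ring.
by rewrite !adj // !addr0.
Qed.
End Configurations.

Lemma reflection_vanish K : sym K ->
  K - rf true false K - rf false true K + rf true true K = 0.
Proof.
pose inc : {rmorphism {poly F} -> {fraction {poly F}}} := @FracField.tofrac _.
have inc_inj : injective inc by move=> p q /eqP; rewrite tofrac_eq => /eqP.
have six_neq0 : 6 != 0 :> F.
  by rewrite (_ : 6 = 2 * 3) ?mulf_neq0 //; ring.
(* [phi] and [psi] take the values [e] and [d] at [pt e d]: there the crosses
   specialize to the generic solution or to one of its reflections. *)
pose phi : {poly F} := 2^-1 *: ('X * ('X + 1)).
pose psi : {poly F} := 6^-1 *: ('X * ('X - 1) * (2 *: 'X + 5%:P)).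
pose pt (e d : bool) : F := if d then (if e then - 2 else - 1) else (if e then 1 else 0).
apply: (@reflection_mixed _ inc inc_inj phi psi pt) => e d.
- by rewrite /phi /pt !hornerE; case: e; case: d => /=; field.
- by rewrite /psi /pt !hornerE; case: e; case: d => /=; field; rewrite ?six_neq0.
Qed.
End Mixed.

(** * Exact transport of the nonlocal terms *)

(** The antisymmetric pairing of two solutions of the linearized equation is closed: solving both
    equations for the corner with coefficient [a] leaves a rational identity. *)
Lemma conservation_law (F : fieldType) (a b c d K K1 X X1 L L1 Y Y1 : F) :
  a != 0 -> b != 0 -> c != 0 -> d != 0 ->
  d * K + b * X + c * K1 + a * X1 = 0 -> d * L + b * Y + c * L1 + a * Y1 = 0 ->
  (Y * X1 - Y1 * X) / - (c * d) - (L * K1 - L1 * K) / - (a * b)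
  = (Y1 * K1 - X1 * L1) / - (b * d) - (Y * K - X * L) / - (a * c).
Proof.
move=> na nb nc nd eK eL.
have solve x y : x + a * y = 0 -> y = - x / a.
  by move/eqP; rewrite addrC addr_eq0 => /eqP <-; rewrite mulrC mulKf.
rewrite (solve _ _ eK) (solve _ _ eL).
by field; rewrite ?oppr_eq0 ?mulf_eq0 ?negb_or ?na ?nb ?nc ?nd.
Qed.

Section Exactness.
Variables (C F : fieldType) (cs : {rmorphism C -> F}).
Variables (sh : int -> int -> {rmorphism F -> F}) (rf : bool -> bool -> {rmorphism F -> F}).
Hypothesis sh_c : forall p q c, sh p q (cs c) = cs c.
Hypothesis rf_c : forall e d c, rf e d (cs c) = cs c.
Hypothesis sh_sh : forall p q p' q' x, sh p q (sh p' q' x) = sh (p + p') (q + q') x.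
Hypothesis sh0 : forall x, sh 0 0 x = x.
Hypothesis rf_sh : forall e d p q x, rf e d (sh p q x) = sh (sg e p) (sg d q) (rf e d x).
Hypothesis rf_rf : forall x, rf true false (rf false true x) = rf true true x.
Hypothesis kerDelta : forall x, sh 1 0 x = x -> exists c, x = cs c.
Hypothesis two_neq0 : 2 != 0 :> F.
Variables a b c d : F.
Hypotheses (aN : a != 0) (bN : b != 0) (cN : c != 0) (dN : d != 0).
Definition dot (K : F) := d * K + b * sh 0 1 K + c * sh 1 0 K + a * sh 1 1 K.
Hypothesis sym_rf : forall e d K, dot K = 0 -> dot (rf e d K) = 0.
Hypothesis vanish : forall K, dot K = 0 ->
  K - rf true false K - rf false true K + rf true true K = 0.
Variables h g : F.
Hypotheses (hE : h = - (a * b)) (ThE : sh 0 1 h = - (c * d)).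
Hypotheses (gE : g = - (a * c)) (SgE : sh 1 0 g = - (b * d)).
Hypotheses (h_iota : rf true false h = sh (-1) 0 h) (h_tau : rf false true h = h).
Hypotheses (g_iota : rf true false g = g) (g_tau : rf false true g = sh 0 (-1) g).

Variable L : F.
Hypotheses (symL : dot L = 0) (L_iota : rf true false L = - L).
Hypothesis L_tau : rf false true L = L.

Let S := sh 1 0.
Let T := sh 0 1.
Definition density K := (L * S K - S L * K) / h.
Definition flux K := (T L * K - T K * L) / g.
Definition defect K th := T th - th - flux K.

Lemma defectB K K' th th' : defect (K - K') (th - th') = defect K th - defect K' th'.
Proof. by rewrite /defect /flux !rmorphB; ring. Qed.

Lemma densityB K K' : density (K - K') = density K - density K'.
Proof. by rewrite /density !rmorphB; ring. Qed.

(** By [conservation_law] the defect is invariant under [S]. *)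
Lemma defect_const K th : dot K = 0 -> S th - th = density K ->
  exists k, defect K th = cs k.
Proof.
move=> sK /eqP; rewrite subr_eq => /eqP thE; apply: kerDelta.
rewrite -/S /defect /flux.
have ST x : S (T x) = sh 1 1 x by rewrite sh_sh.
have TS x : T (S x) = sh 1 1 x by rewrite sh_sh.
rewrite !rmorphB fmorph_div !rmorphB !rmorphM !ST -TS thE /density.
rewrite rmorphD fmorph_div rmorphB !rmorphM !TS ThE SgE hE gE.
have := conservation_law aN bN cN dN sK symL.
set A1 := _ / _; set A2 := _ / _; set A3 := _ / _; set A4 := _ / _ => e.
by move/eqP: e; rewrite subr_eq => /eqP ->; ring.
Qed.

(** This reflection inverts [T], so the transport is read backwards and the defect changes sign.
    Being constant, it is itself fixed by [T^-1] and by the reflection. *)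
Lemma defect_tau K th : dot K = 0 -> S th - th = density K ->
  S (rf false true th) - rf false true th = density (rf false true K)
  /\ defect (rf false true K) (rf false true th) = - defect K th.
Proof.
move=> sK thE; split.
  have := congr1 (rf false true) thE; rewrite /density fmorph_div !rmorphB !rmorphM.
  by rewrite !rf_sh L_tau h_tau /= oppr0.
have [k kE] := defect_const sK thE.
have := congr1 (fun x => rf false true (sh 0 (-1) x)) kE.
rewrite /= sh_c rf_c -kE => <-.
rewrite /defect /flux !rmorphB !fmorph_div !rmorphB !rmorphM !sh_sh !rf_sh.
rewrite /= !oppr0 ?addr0 ?addNr ?subrr ?opprK ?sh0 !L_tau.
rewrite g_tau sh_sh /= addr0 addrN sh0 /T; ring.
Qed.

(** Here [S] is inverted, which puts the sign on the antiderivative; [L] being odd, the flux changes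
    sign as well. *)
Lemma defect_iota K th : dot K = 0 -> S th - th = density K ->
  S (- rf true false th) - (- rf true false th) = density (rf true false K)
  /\ defect (rf true false K) (- rf true false th) = - defect K th.
Proof.
move=> sK thE; split.
  have := congr1 (fun x => sh 1 0 (rf true false x)) thE.
  rewrite /density !(rmorphB, rmorphM, fmorphV).
  rewrite !rf_sh L_iota h_iota !rmorphN !sh_sh /= ?oppr0 ?addr0 ?addrN ?sh0 /S.
  rewrite opprK => e.
  by rewrite addrC e; ring.
have [k kE] := defect_const sK thE.
have := congr1 (rf true false) kE; rewrite rf_c -kE => <-.
rewrite /defect /flux !(rmorphB, rmorphM, fmorphV, rmorphN) !rf_sh /=.
by rewrite oppr0 L_iota g_iota !rmorphN /T; ring.
Qed.

(** The alternating sum over the reflections replaces [K] by 0, by [vanish], and the defect by 4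
    times itself. The corresponding antiderivative is then a constant, whose defect is 0. *)
Lemma flux_exact K th : dot K = 0 -> S th - th = density K ->
  T th - th = flux K.
Proof.
move=> sK thE.
have [tE td] := defect_tau sK thE.
have [iE idf] := defect_iota sK thE.
have [itE itd] := defect_iota (sym_rf false true sK) tE.
set K1 := rf true false K in iE idf; set K2 := rf false true K in tE td itE itd.
set K3 := rf true false K2 in itE itd.
set th1 := - rf true false th in iE idf; set th2 := rf false true th in tE td itE itd.
set th3 := - rf true false th2 in itE itd.
have Ks0 : (K - K1) - (K2 - K3) = 0.
  by rewrite -[RHS](vanish sK) /K3 /K2 rf_rf /K1; ring.
have eD : defect ((K - K1) - (K2 - K3)) ((th - th1) - (th2 - th3)) = 4 * defect K th.
  by rewrite !defectB itd td idf; ring.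
have eS : S ((th - th1) - (th2 - th3)) = (th - th1) - (th2 - th3).
  apply/eqP; rewrite -subr_eq0; apply/eqP.
  transitivity (density ((K - K1) - (K2 - K3))); last first.
    by rewrite Ks0 /density !rmorph0; ring.
  by rewrite !densityB -thE -iE -tE -itE !rmorphB; ring.
have [k kE] := kerDelta eS.
have four0 : 4 != 0 :> F by rewrite (_ : 4 = 2 * 2) ?mulf_neq0 //; ring.
apply/eqP; rewrite -subr_eq0 -/(defect K th) -(inj_eq (mulfI four0)) mulr0.
by rewrite -eD Ks0 kE /defect /flux /T sh_c rmorph0; apply/eqP; ring.
Qed.
End Exactness.

(** * The recursion operator on two rows *)

Section Glue.
Variables (C F : fieldType) (cs : {rmorphism C -> F}).
Variables (t : nat -> F) (u : int -> int -> F) (sh : int -> int -> {rmorphism F -> F}).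
Hypothesis sh_c : forall p q c, sh p q (cs c) = cs c.
Hypothesis sh_t : forall p q i, sh p q (t i) = t i.
Hypothesis sh_u : forall p q i j, sh p q (u i j) = u (i + p) (j + q).
Hypothesis sh_sh : forall p q p' q' x, sh p q (sh p' q' x) = sh (p + p') (q + q') x.
Hypothesis sh0 : forall x, sh 0 0 x = x.
Hypothesis two_neq0 : 2 != 0 :> F.
Hypothesis u_square_A : forall p q (a b : bool),
  Af t (u (p + a%:Z) (q + b%:Z)) (u (p + (~~ a)%:Z) (q + b%:Z))
    (u (p + a%:Z) (q + (~~ b)%:Z)) != 0.
Hypothesis u_Q : forall p q,
  Qf t (u p q) (u (p + 1) q) (u p (q + 1)) (u (p + 1) (q + 1)) = 0.
Hypothesis u_step2_neq : u 1 0 != u (- 1) 0.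
Variable rf : bool -> bool -> {rmorphism F -> F}.
Hypothesis rf_c : forall e d c, rf e d (cs c) = cs c.
Hypothesis rf_t : forall e d i, rf e d (t i) = t i.
Hypothesis rf_u : forall e d p q, rf e d (u p q) = u (sg e p) (sg d q).
Hypothesis rf_sh : forall e d p q x, rf e d (sh p q x) = sh (sg e p) (sg d q) (rf e d x).
Hypothesis rf_rf : forall x, rf true false (rf false true x) = rf true true x.
Hypothesis kerDelta : forall x, sh 1 0 x = x -> exists c, x = cs c.
Hypothesis sym_rf : forall e d K, sym t u sh K -> sym t u sh (rf e d K).
Hypothesis vanish : forall K, sym t u sh K ->
  K - rf true false K - rf false true K + rf true true K = 0.

Definition hF := hf t (u 0 0) (u 1 0).
Definition wF := (u 1 0 - u (- 1) 0)^-1.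
(* This is [2 K1]. *)
Definition kF := 2 * (hF * wF) - dhf t (u 0 0) (u 1 0).
Definition mF := hF * sh (- 1) 0 hF * wF ^+ 2 * (sh 1 0 wF + sh (- 1) 0 wF).
Definition gF := gf t (u 0 0) (u 0 1).
(** [th1] and [th2] are antiderivatives of the densities of [K2] and [2 K1]. Compared with the
    nonlocal terms of [opR], they have absorbed the local term with factor [2 / h_{-1}]. *)
Definition rF K th1 th2 :=
  hF * sh (- 1) 0 hF * wF ^+ 2
    * ((sh 1 0 wF) ^+ 2 * sh 2 0 K + (sh (- 1) 0 wF) ^+ 2 * sh (- 2) 0 K)
  + kF * mF * (sh 1 0 K / hF + sh (- 1) 0 K / sh (- 1) 0 hF)
  - wF ^+ 2 * (sh (- 1) 0 hF * sh 1 0 hF * (sh 1 0 wF) ^+ 2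
     + sh (- 2) 0 hF * hF * (sh (- 1) 0 wF) ^+ 2) * K
  + kF * th1 + mF * th2.

(** Column [n] stands for the abscissa [n - 2], since the operator reaches two steps back. *)
Let z (j : int) (n : nat) := u (n%:Z - 2) j.
Let ww j (n : nat) := (z j n.+1 - z j n.-1)^-1.
Let KK j K (n : nat) := sh (n%:Z - 2) j K.

Lemma sh_hF p j (n : nat) : p = n%:Z - 2 -> sh p j hF = row_h t (z j) n.
Proof.
move=> ->; rewrite /hF (rmorph_hf (sh_t _ _)) !sh_u /row_h /z.
by congr (hf t (u _ _) (u _ _)); lia.
Qed.
Lemma sh_wF p j (n : nat) : p = n.+1%:Z - 2 -> sh p j wF = ww j n.+1.
Proof.
move=> ->; rewrite /wF fmorphV rmorphB !sh_u /ww /z /=.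
by congr ((u _ _ - u _ _)^-1); lia.
Qed.
Lemma sh_kF p j (n : nat) : p = n.+1%:Z - 2 -> sh p j kF = row_k t (z j) (ww j) n.+1.
Proof.
move=> pE; rewrite /kF /row_k rmorphB !rmorphM (sh_hF _ pE) (sh_wF _ pE) rmorph_nat.
congr (_ - _); rewrite (rmorph_dhf (sh_t _ _)) !sh_u /z.
by congr (dhf t (u _ _) (u _ _)); lia.
Qed.
Lemma sh_mF p j (n : nat) : p = n.+2%:Z - 2 -> sh p j mF = row_m t (z j) (ww j) n.+2.
Proof.
have gen (f : {rmorphism F -> F}) a b v c d :
    f (a * b * v ^+ 2 * (c + d)) = f a * f b * f v ^+ 2 * (f c + f d).
  by rewrite !(rmorphM, rmorphD, rmorphXn).
move=> pE; have e1 : p + 1 = n.+3%:Z - 2 by lia.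
have e2 : p - 1 = n.+1%:Z - 2 by lia.
rewrite /mF gen !sh_sh !addr0 (sh_hF j pE) (sh_hF j e2).
by rewrite (sh_wF j pE) (sh_wF j e1) (sh_wF j e2).
Qed.

Lemma sh_rF i j (n : nat) K th1 th2 : i = n.+2%:Z - 2 ->
  sh i j (rF K th1 th2) = recursion (row_h t (z j)) (ww j) (row_k t (z j) (ww j))
    (row_m t (z j) (ww j)) (KK j K) n.+2 (sh i j th1) (sh i j th2).
Proof.
have gen (f : {rmorphism F -> F}) h0 hm1 hm2 h1 w0 w1 wm1 k m K0 K1 K2 Km1 Km2 s1 s2 :
  f (h0 * hm1 * w0 ^+ 2 * (w1 ^+ 2 * K2 + wm1 ^+ 2 * Km2)
    + k * m * (K1 / h0 + Km1 / hm1)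
    - w0 ^+ 2 * (hm1 * h1 * w1 ^+ 2 + hm2 * h0 * wm1 ^+ 2) * K0 + k * s1 + m * s2)
  = f h0 * f hm1 * f w0 ^+ 2 * (f w1 ^+ 2 * f K2 + f wm1 ^+ 2 * f Km2)
    + f k * f m * (f K1 / f h0 + f Km1 / f hm1)
    - f w0 ^+ 2 * (f hm1 * f h1 * f w1 ^+ 2 + f hm2 * f h0 * f wm1 ^+ 2) * f K0
    + f k * f s1 + f m * f s2.
  by rewrite !(rmorphD, rmorphN, rmorphXn, rmorphM, fmorphV).
move=> iE; have e1 : i + 1 = n.+3%:Z - 2 by lia.
have e2 : i - 1 = n.+1%:Z - 2 by lia.
have e3 : i + 2 = n.+4%:Z - 2 by lia.
have e4 : i - 2 = n%:Z - 2 by lia.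
rewrite /rF gen /recursion /KK !sh_sh !addr0.
rewrite (sh_hF j iE) (sh_hF j e1) (sh_hF j e2) (sh_hF j e4).
rewrite (sh_wF j iE) (sh_wF j e1) (sh_wF j e2) (sh_kF j iE) (sh_mF j iE).
by rewrite e1 e2 e3 e4 -iE.
Qed.

Let x := z 0. Let y := z 1.
Let a n := Af t (x n) (x n.+1) (y n).
Let b n := Af t (x n.+1) (x n) (y n.+1).
Let c n := Af t (y n) (y n.+1) (x n).
Let d n := Af t (y n.+1) (y n) (x n.+1).

Let zS j (n : nat) : z j n.+1 = u (n%:Z - 2 + 1) j.
Proof. by rewrite /z; congr u; lia. Qed.
Let Qn n : Qf t (x n) (x n.+1) (y n) (y n.+1) = 0.
Proof. by rewrite /x /y !zS; exact: (u_Q (n%:Z - 2) 0). Qed.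
Let aN n : a n != 0.
Proof. by rewrite /a /x /y !zS; have := u_square_A (n%:Z - 2) 0 false false; rewrite !addr0. Qed.
Let bN n : b n != 0.
Proof. by rewrite /b /x /y !zS; have := u_square_A (n%:Z - 2) 0 true false; rewrite !addr0. Qed.
Let cN n : c n != 0.
Proof. by rewrite /c /x /y !zS; have := u_square_A (n%:Z - 2) 0 false true; rewrite !addr0. Qed.
Let dN n : d n != 0.
Proof. by rewrite /d /x /y !zS; have := u_square_A (n%:Z - 2) 0 true true; rewrite !addr0. Qed.
Let wwP j n : ww j n.+1 * (z j n.+2 - z j n) = 1.
Proof.
rewrite /ww /= mulVf // subr_eq0.
have gen (f : {rmorphism F -> F}) v v' r r' : f v = v' -> f r = r' -> v != r -> v' != r'.
  by move=> <- <-; rewrite (inj_eq (fmorph_inj f)).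
apply: gen (sh (n%:Z - 1) j) _ _ _ _ _ _ u_step2_neq; rewrite sh_u /z add0r; congr u; lia.
Qed.

Let hE : hF = - (cA t u * cB t u).
Proof. exact: hf_on_shell (Qn 2). Qed.
Let ThE : sh 0 1 hF = - (cC t u * cD t u).
Proof.
rewrite (@sh_hF 0 1 2) //; apply: (hf_on_shell (x := y 2) (X := y 3) (y := x 2) (Y := x 3)).
by rewrite Qf_swap_row; apply: Qn.
Qed.
Let sh_gF (n : nat) p : p = n%:Z - 2 -> sh p 0 gF = gf t (x n) (y n).
Proof.
move=> ->; rewrite /gF (rmorph_gf (sh_t _ _)) !sh_u /x /y /z.
by congr (gf t (u _ _) (u _ _)); lia.
Qed.
Let gE n : gf t (x n) (y n) = - (a n * c n).
Proof. exact: gf_on_shell (Qn n). Qed.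

Lemma kF_sym : sym t u sh kF.
Proof.
have := row_k_symmetry Qn (wwP 0) (wwP 1) 1; rewrite -/x -/y.
rewrite -[_ t x (ww 0) _](@sh_kF 0 0 1) // -[_ t x (ww 0) _](@sh_kF 1 0 2) //.
rewrite -[_ t y (ww 1) _](@sh_kF 0 1 1) // -[_ t y (ww 1) _](@sh_kF 1 1 2) //.
by rewrite sh0.
Qed.

Lemma mF_sym : sym t u sh mF.
Proof.
have := row_m_symmetry Qn (wwP 0) (wwP 1) 0; rewrite -/x -/y.
rewrite -[_ t x (ww 0) _](@sh_mF 0 0 0) // -[_ t x (ww 0) _](@sh_mF 1 0 1) //.
rewrite -[_ t y (ww 1) _](@sh_mF 0 1 0) // -[_ t y (ww 1) _](@sh_mF 1 1 1) //.
by rewrite sh0.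
Qed.

Let rf_h_iota : rf true false hF = sh (- 1) 0 hF.
Proof.
rewrite /hF (rmorph_hf (rf_t _ _)) (rmorph_hf (sh_t _ _)) !rf_u !sh_u hf_sym.
by congr (hf t (u _ _) (u _ _)).
Qed.
Let rf_h_tau : rf false true hF = hF.
Proof. by rewrite /hF (rmorph_hf (rf_t _ _)) !rf_u; congr (hf t (u _ _) (u _ _)). Qed.
Let rf_g_iota : rf true false gF = gF.
Proof. by rewrite /gF (rmorph_gf (rf_t _ _)) !rf_u; congr (gf t (u _ _) (u _ _)). Qed.
Let rf_g_tau : rf false true gF = sh 0 (- 1) gF.
Proof.
rewrite /gF (rmorph_gf (rf_t _ _)) (rmorph_gf (sh_t _ _)) !rf_u !sh_u gf_sym.
by congr (gf t (u _ _) (u _ _)).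
Qed.
Let rf_w_iota : rf true false wF = - wF.
Proof. by rewrite /wF -invrN opprB fmorphV rmorphB !rf_u; congr ((u _ _ - u _ _)^-1). Qed.
Let rf_w_tau : rf false true wF = wF.
Proof. by rewrite /wF fmorphV rmorphB !rf_u; congr ((u _ _ - u _ _)^-1). Qed.

Let wF1 : wF * (u 1 0 - u (- 1) 0) = 1.
Proof. by rewrite /wF mulVf // subr_eq0. Qed.
(** Reversal exchanges the two expressions of [two_forms] up to sign. *)
Let rf_k_iota : rf true false kF = - kF.
Proof.
have gen (f : {rmorphism F -> F}) p q e : f (2 * (p * q) - e) = 2 * (f p * f q) - f e.
  by rewrite rmorphB !rmorphM rmorph_nat.
have two := two_forms t (u 0 0) wF1.
transitivity (- (2 * (hf t (u (- 1) 0) (u 0 0) * wF) + dhf t (u 0 0) (u (- 1) 0))); last by rewrite -two.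
rewrite /kF gen rf_h_iota rf_w_iota (rmorph_dhf (rf_t _ _)) !rf_u.
have -> : sh (- 1) 0 hF = hf t (u (- 1) 0) (u 0 0).
  by rewrite /hF (rmorph_hf (sh_t _ _)) !sh_u; congr (hf t (u _ _) (u _ _)).
have gen2 (p q e e' : F) : e = e' -> 2 * (p * - q) - e = - (2 * (p * q) + e').
  by move=> ->; ring.
by apply: gen2; congr (dhf t (u _ _) (u _ _)).
Qed.
Let rf_k_tau : rf false true kF = kF.
Proof.
have gen (f : {rmorphism F -> F}) p q e : f (2 * (p * q) - e) = 2 * (f p * f q) - f e.
  by rewrite rmorphB !rmorphM rmorph_nat.
rewrite /kF gen rf_h_tau rf_w_tau (rmorph_dhf (rf_t _ _)) !rf_u.
by congr (_ - dhf t (u _ _) (u _ _)).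
Qed.
Let gen_m (f : {rmorphism F -> F}) p q v r s :
    f (p * q * v ^+ 2 * (r + s)) = f p * f q * f v ^+ 2 * (f r + f s).
Proof. by rewrite !(rmorphM, rmorphD, rmorphXn). Qed.
Let rf_m_iota : rf true false mF = - mF.
Proof.
rewrite /mF gen_m !rf_sh rf_h_iota rf_w_iota sh_sh.
have -> : sh (sg true (- 1) - 1) (sg false 0 + 0) hF = hF.
  by rewrite -[RHS]sh0; congr (sh _ _ hF).
rewrite !rmorphN.
have -> : sh (sg true 1) (sg false 0) wF = sh (- 1) 0 wF by congr (sh _ _ wF).
have -> : sh (sg true (- 1)) (sg false 0) wF = sh 1 0 wF by congr (sh _ _ wF).
by rewrite sqrrN; ring.
Qed.
Let rf_m_tau : rf false true mF = mF.
Proof.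
rewrite /mF gen_m !rf_sh rf_h_tau rf_w_tau.
by congr (hF * sh _ _ hF * wF ^+ 2 * (sh _ _ wF + sh _ _ wF)).
Qed.

Let SgE : sh 1 0 gF = - (cB t u * cD t u).
Proof.
rewrite (@sh_gF 3 1) //.
by apply: (gf_on_shell (X := x 2) (Y := y 2)); rewrite Qf_swap_col; apply: Qn.
Qed.

Section RecursionOfSymmetry.
Variables K th1 th2 : F.
Hypothesis symK : sym t u sh K.
Hypothesis th1P : sh 1 0 th1 - th1 = (mF * sh 1 0 K - sh 1 0 mF * K) / hF.
Hypothesis th2P : sh 1 0 th2 - th2 = (kF * sh 1 0 K - sh 1 0 kF * K) / hF.

Let exact_flux L th : sym t u sh L -> rf true false L = - L -> rf false true L = L ->
  sh 1 0 th - th = (L * sh 1 0 K - sh 1 0 L * K) / hF ->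
  sh 0 1 th = th + (sh 0 1 L * K - sh 0 1 K * L) / gF.
Proof.
move=> sL Li Lt thE; apply/eqP; rewrite addrC -subr_eq; apply/eqP.
exact: (flux_exact sh_c rf_c sh_sh sh0 rf_sh rf_rf kerDelta two_neq0 (aN 2) (bN 2) (cN 2) (dN 2)
  sym_rf vanish hE ThE (gE 2) SgE rf_h_iota rf_h_tau rf_g_iota rf_g_tau sL Li Lt symK thE).
Qed.

(** The values of the antiderivatives at the other corners come from [th1P] and [th2P] along the row
    and from [exact_flux] across rows; they are the increments that [recursion_symmetry] expects. *)
Lemma rF_sym : sym t u sh (rF K th1 th2).
Proof.
have lin n : d n * KK 0 K n + b n * KK 1 K n + c n * KK 0 K n.+1 + a n * KK 1 K n.+1 = 0.
  pose p := n%:Z - 2.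
  have z0 : sh p 0 0 = 0 by rewrite rmorph0.
  rewrite -[RHS]z0 -symK rmorph_dot4 !sh_sh.
  have coef i1 j1 i2 j2 i3 j3 : sh p 0 (Af t (u i1 j1) (u i2 j2) (u i3 j3))
      = Af t (u (i1 + p) (j1 + 0)) (u (i2 + p) (j2 + 0)) (u (i3 + p) (j3 + 0)).
    by rewrite (rmorph_Af (sh_t p 0)) !sh_u.
  rewrite /cA /cB /cC /cD !coef /KK /a /b /c /d /x /y /z /p.
  have e1 : n.+1%:Z - 2 = 1 + (n%:Z - 2) by lia.
  by rewrite e1 !add0r !addr0 (addrC _ 1).
have mE j : row_m t (z j) (ww j) 2 = sh 0 j mF by rewrite (@sh_mF 0 j 0).
have mE' j : row_m t (z j) (ww j) 3 = sh 1 j mF by rewrite (@sh_mF 1 j 1).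
have kE j : row_k t (z j) (ww j) 2 = sh 0 j kF by rewrite (@sh_kF 0 j 1).
have kE' j : row_k t (z j) (ww j) 3 = sh 1 j kF by rewrite (@sh_kF 1 j 2).
have hE2 : row_h t x 2 = hF by rewrite -(@sh_hF 0 0 2) ?sh0.
have gE2 : - (a 2 * c 2) = gF by rewrite -gE -(@sh_gF 2 0) ?sh0.
have gE3 : - (a 3 * c 3) = sh 1 0 gF by rewrite -gE -(@sh_gF 3 1).
have K02 : KK 0 K 2 = K by exact: sh0.
have K03 : KK 0 K 3 = sh 1 0 K by [].
have K12 : KK 1 K 2 = sh 0 1 K by [].
have K13 : KK 1 K 3 = sh 1 1 K by [].
have step L f g th : sym t u sh L -> rf true false L = - L -> rf false true L = L ->
    f 2%N = sh 0 0 L -> f 3%N = sh 1 0 L -> g 2%N = sh 0 1 L -> g 3%N = sh 1 1 L ->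
    sh 1 0 th - th = (L * sh 1 0 K - sh 1 0 L * K) / hF ->
  [/\ sh 0 1 th = th + row_flux t x y (KK 0 K) (KK 1 K) f g 2,
      sh 1 0 th = th + row_density t x (KK 0 K) f 2
    & sh 1 1 th = th + row_density t x (KK 0 K) f 2
                  + row_flux t x y (KK 0 K) (KK 1 K) f g 3].
  move=> sL Li Lt f2 f3 g2 g3 thE.
  have Tth := exact_flux sL Li Lt thE.
  have Sth : sh 1 0 th = th + (L * sh 1 0 K - sh 1 0 L * K) / hF.
    by rewrite -thE addrC subrK.
  rewrite /row_flux /row_density -/(a 2) -/(c 2) -/(a 3) -/(c 3) hE2 gE2 gE3.
  rewrite f2 f3 g2 g3 K02 K03 K12 K13 sh0; split=> //.
  have gen (f' : {rmorphism F -> F}) p q r s e e' : f' (p + (q * r - s * e) / e')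
      = f' p + (f' q * f' r - f' s * f' e) / f' e'.
    by rewrite rmorphD fmorph_div rmorphB !rmorphM.
  have -> : sh 1 1 th = sh 1 0 (sh 0 1 th) by rewrite sh_sh.
  by rewrite Tth gen !sh_sh Sth.
have [t1 s1 st1] := step mF (row_m t x (ww 0)) (row_m t y (ww 1)) th1 mF_sym rf_m_iota rf_m_tau
  (mE 0) (mE' 0) (mE 1) (mE' 1) th1P.
have [t2 s2 st2] := step kF (row_k t x (ww 0)) (row_k t y (ww 1)) th2 kF_sym rf_k_iota rf_k_tau
  (kE 0) (kE' 0) (kE 1) (kE' 1) th2P.
have := recursion_symmetry Qn aN bN cN dN (wwP 0) (wwP 1) lin th1 th2.
rewrite -{}st1 -{}st2 -{}t1 -{}t2 -{}s1 -{}s2.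
rewrite -(@sh_rF 0 1 0) // -(@sh_rF 1 0 1) // -(@sh_rF 1 1 1) //.
have -> : recursion (row_h t x) (ww 0) (row_k t x (ww 0)) (row_m t x (ww 0)) (KK 0 K) 2 th1 th2
    = rF K th1 th2.
  by rewrite -[RHS]sh0 (@sh_rF 0 0 0) // !sh0.
by [].
Qed.
End RecursionOfSymmetry.
End Glue.

(** * The field of the Viallet equation *)

Section EvalU.
Variables (C : fieldType).
Local Notation I := (int * int)%type.

Lemma mkmalgU_mul (k1 k2 : {cmonom I}) (c1 c2 : C) :
  mkmalgU (mmul k1 k2) (c1 * c2) = mkmalgU k1 c1 * mkmalgU k2 c2 :> CU C.
Proof. by rewrite malgM_def fgmulUU. Qed.

(** Monomials are reached by induction on the degree, splitting off one variable of the support at a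
    time. *)
Lemma CU_ind (P : CU C -> Prop) :
  (forall c, P (cstU c)) -> (forall p q, P (varU C p q)) ->
  (forall a b, P a -> P b -> P (a + b)) ->
  (forall a b, P a -> P b -> P (a * b)) -> forall a, P a.
Proof.
move=> Pc Pv PD PM a.
have Pmon n k : mdeg k = n -> P (mkmalgU k 1).
  elim: n k => [|n IH] k kn.
    by rewrite (mdeg_eq0I kn); apply: Pc.
  have k1 : k != mone by rewrite -mdeg_eq0 kn.
  have [i ik] : exists i, (0 < k i)%N.
    case: (fset_0Vmem (finsupp k)) => [s0|[i iS]]; last first.
      by exists i; rewrite lt0n cmE_neq0.
    by move: kn; rewrite mdegE s0 big_seq_fset0.
  have ke : k = mmul (ucm i) (divcm k (ucm i)).
    apply/eqP/cmP => j; rewrite cmM divcmE cmU.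
    by case: eqP => [<-|]; rewrite ?subn0 // subnKC.
  rewrite ke -[1](mulr1 1) mkmalgU_mul; apply: PM; first by case: (i) => p q; exact: Pv.
  apply: IH; move: kn; rewrite {1}ke mdegM mdegU add1n => -[] //.
rewrite (monalgE a); elim/big_ind: _ => //.
- by rewrite -(@malgC0E _ C); exact: Pc.
- by move=> k _; rewrite -[a@_k]mulr1 -(mul1m k) mkmalgU_mul mul1m; apply: PM; [exact: Pc | exact: Pmon].
Qed.

Section Ev.
Variables (E : comNzRingType) (f : {rmorphism C -> E}) (U : int -> int -> E).
Definition evm (m : {cmonom I}) : E :=
  \prod_(i <- finsupp m) U i.1 i.2 ^+ m i.

Lemma evm_w (d : {fset I}) (m : {cmonom I}) :
  (finsupp m `<=` d)%fset -> evm m = \prod_(i <- d) U i.1 i.2 ^+ m i.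
Proof.
move=> sd; rewrite /evm (big_fset_incl _ sd) // => i _.
by rewrite -cmE_eq0 => /eqP ->.
Qed.

Lemma evm_mmorphism : mmorphism evm.
Proof.
split=> [m1 m2|]; last by rewrite /evm mdom1 big_seq_fset0.
rewrite (evm_w (fsubsetUl (finsupp m1) (finsupp m2))).
rewrite (evm_w (fsubsetUr (finsupp m1) (finsupp m2))).
by rewrite /evm mdomD -big_split; apply/eq_bigr => i _; rewrite cmM exprD.
Qed.
HB.instance Definition _ := isMultiplicative.Build _ _ evm evm_mmorphism.

Definition evU : {rmorphism CU C -> E} := mmap f evm.

Lemma evU_cst c : evU (cstU c) = f c.
Proof. exact: mmapC. Qed.

Lemma evU_var p q : evU (varU C p q) = U p q.
Proof. 
rewrite /evU /= mmapU.
rewrite (_ : _ 1 = 1); last exact: rmorph1.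
by rewrite mul1r /evm mdomU big_seq_fset1 cmU eqxx expr1.
Qed.
End Ev.

Lemma CU_hom_ext (E : comNzRingType) (f g : {rmorphism CU C -> E}) :
  (forall c, f (cstU c) = g (cstU c)) ->
  (forall p q, f (varU C p q) = g (varU C p q)) -> f =1 g.
Proof.
move=> fc fv; elim/CU_ind => // a b fa fb; first by rewrite !rmorphD fa fb.
by rewrite !rmorphM fa fb.
Qed.
End EvalU.

(* Imported only here: mpoly hides the coefficient notation [a@_k] of monalg. *)
From mathcomp Require Import reals complex mpoly.

(** * Derivatives of the Viallet polynomial *)

Section Derivatives.
Variables (C : fieldType) (av : nat -> C).
Local Notation Q :=
  (viallet (av 1) (av 2) (av 3) (av 4) (av 5) (av 6) (av 7)).

Lemma corner_inj i j k l : (corner i j == corner k l) = (i == k) && (j == l).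
Proof. by rewrite -val_eqE /= !inordK; case: i; case: j; case: k; case: l. Qed.

Lemma pdD i j (P R : poly4 C) : pd i j (P + R) = pd i j P + pd i j R.
Proof. exact: mpoly.mderivD. Qed.
Lemma pdB i j (P R : poly4 C) : pd i j (P - R) = pd i j P - pd i j R.
Proof. exact: mpoly.mderivB. Qed.
Lemma pdM i j (P R : poly4 C) : pd i j (P * R) = pd i j P * R + P * pd i j R.
Proof. exact: mpoly.mderivM. Qed.
Lemma pdZ i j c (P : poly4 C) : pd i j (c *: P) = c *: pd i j P.
Proof. exact: mpoly.mderivZ. Qed.
Lemma pd1 i j : pd i j (1 : poly4 C) = 0.
Proof. exact: mpoly.mderivC. Qed.
Lemma pd_vx i j k l : pd i j (vx C k l) = ((i == k) && (j == l))%:R.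
Proof.
rewrite /pd /vx mpoly.mderivX mpoly.mnm1E corner_inj (eq_sym k) (eq_sym l).
case: andP => [[/eqP -> /eqP ->]|_]; last by rewrite scale0r.
rewrite scale1r.
have -> : forall m : 'X_{1..4}, (m - m)%MM = 0%MM; last by rewrite mpolyX0.
by move=> m; apply/mnmP => x; rewrite mnmBE mnm0E subnn.
Qed.
Definition pdE := (pdD, pdB, pdM, pdZ, pd1, pd_vx).

Local Notation vars0 := (mulr0, mul0r, addr0, add0r, mulr1, mul1r, scaler0).

Lemma pd11_Q : pd true true Q =
  av 1 *: (vx C false false * vx C true false * vx C false true)
  + av 2 *: (vx C true false * vx C false true
             + vx C false true * vx C false false
             + vx C false false * vx C true false)
  + av 3 *: vx C false true + av 4 *: vx C false false
  + av 5 *: vx C true false + av 6 *: 1.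
Proof. by rewrite /viallet !pdE /= !vars0. Qed.

Lemma pd01_Q : pd false true Q =
  av 1 *: (vx C false false * vx C true false * vx C true true)
  + av 2 *: (vx C false false * vx C true false
             + vx C true false * vx C true true
             + vx C true true * vx C false false)
  + av 3 *: vx C true true + av 4 *: vx C true false
  + av 5 *: vx C false false + av 6 *: 1.
Proof. by rewrite /viallet !pdE /= !vars0. Qed.

Lemma pd01_11_Q : pd false true (pd true true Q) =
  av 1 *: (vx C false false * vx C true false)
  + av 2 *: (vx C true false + vx C false false) + av 3 *: 1.
Proof. by rewrite pd11_Q !pdE /= !vars0. Qed.

Lemma pd10_01_11_Q : pd true false (pd false true (pd true true Q)) =
  av 1 *: vx C false false + av 2 *: 1.
Proof. by rewrite pd01_11_Q !pdE /= !vars0. Qed.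

Section Eval.
Variables (E : fieldType) (g : {rmorphism poly4 C -> E}).
Let t i := g (mpoly.mpolyC 4 (av i)).
Local Notation x := (g (vx C false false)).
Local Notation X := (g (vx C true false)).
Local Notation y := (g (vx C false true)).
Local Notation Y := (g (vx C true true)).

Let gZ i P : g (av i *: P) = t i * g P.
Proof. by rewrite -mpoly.mul_mpolyC rmorphM. Qed.

Let evE := (rmorphD, gZ, rmorphM, rmorph1).

(** The morphism [g] is arbitrary, so that these formulas apply to all instances of [Q] in [C[U]]
    and to their images in any field. *)
Lemma ev_Q : g Q = Qf t x X y Y.
Proof. by rewrite /viallet !evE /Qf; ring. Qed.
Lemma ev_Q11 : g (pd true true Q) = Af t x X y.
Proof. by rewrite pd11_Q !evE /Af; ring. Qed.
Lemma ev_Q01 : g (pd false true Q) = Af t X x Y.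
Proof. by rewrite pd01_Q !evE /Af; ring. Qed.
Lemma ev_Q10 : g (pd true false Q) = Af t y Y x.
Proof. by rewrite /viallet !pdE /= !vars0 !evE /Af; ring. Qed.
Lemma ev_Q00 : g (pd false false Q) = Af t Y y X.
Proof. by rewrite /viallet !pdE /= !vars0 !evE /Af; ring. Qed.
Lemma ev_Q01_11 : g (pd false true (pd true true Q)) = d2f t 3 x X.
Proof. by rewrite pd01_11_Q !evE /d2f; ring. Qed.
Lemma ev_Q10_11 : g (pd true false (pd true true Q)) = d2f t 5 x y.
Proof. by rewrite pd11_Q !pdE /= !vars0 !evE /d2f; ring. Qed.
Lemma ev_Q10_01 : g (pd true false (pd false true Q)) = d2f t 4 x Y.
Proof.
by rewrite pd01_Q !pdE /= !vars0 !evE /d2f; ring.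
Qed.
Lemma ev_Q10_01_11 :
  g (pd true false (pd false true (pd true true Q))) = t 1 * x + t 2.
Proof. by rewrite pd10_01_11_Q !evE; ring. Qed.

Lemma ev_h : g (hpoly Q) = hf t x X.
Proof.
rewrite /hpoly rmorphB !rmorphM ev_Q ev_Q11 ev_Q01 ev_Q01_11.
by rewrite /hf /Qf /Af /d2f; ring.
Qed.
Lemma ev_dh : g (pd true false (hpoly Q)) = dhf t x X.
Proof.
rewrite /hpoly pdB !pdM rmorphB !rmorphD !rmorphM.
rewrite ev_Q ev_Q11 ev_Q01 ev_Q10 ev_Q01_11 ev_Q10_01 ev_Q10_11 ev_Q10_01_11.
by rewrite /dhf /Qf /Af /d2f; ring.
Qed.
End Eval.
End Derivatives.

#[local] Opaque varU.

Lemma odd_absz1 (p : int) : odd (absz (p + 1)) = ~~ odd (absz p).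
Proof. by lia. Qed.

(** * Generic and periodic solutions, and embeddings of the field *)

Section Lattice.
Variables (C : fieldType) (av : nat -> C).
Hypothesis two_neq0 : 2 != 0 :> C.
Local Notation Q :=
  (viallet (av 1) (av 2) (av 3) (av 4) (av 5) (av 6) (av 7)).
Hypothesis dQ : pd true true Q != 0.
Variables (F : fieldType) (proj : {rmorphism CU C -> F}).
Hypothesis fracF : is_frac_of_quotient (JQ Q) proj.
Variable sh : int -> int -> {rmorphism F -> F}.
Hypothesis shP : is_shift_action proj sh.
Hypothesis kerDelta : KerDelta_is_C proj sh.

Definition csr : {rmorphism C -> F} := (proj \o @malgC _ C)%FUN.
Definition u p q : F := proj (varU C p q).
Definition t i : F := csr (av i).

Definition inst_hom p q : {rmorphism poly4 C -> CU C} :=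
  mpoly.mmap (@malgC _ C)
    (fun k : 'I_4 => varU C (p + (k %% 2)%N%:Z) (q + (k %/ 2)%N%:Z)).
Lemma inst_homE p q P : inst p q P = inst_hom p q P.
Proof. by []. Qed.

Lemma inst_vx p q i j : inst p q (vx C i j) = varU C (p + i%:Z) (q + j%:Z).
Proof.
rewrite inst_homE /inst_hom /vx /= mpoly.mmapX mpoly.mmap1U /corner.
by case: i; case: j; rewrite inordK.
Qed.

Section InstEval.
Variables (E : fieldType).
Variables (f : {rmorphism CU C -> E}) (fc : nat -> E) (fv : int -> int -> E).
Hypothesis fcE : forall i, f (cstU (av i)) = fc i.
Hypothesis fvE : forall p q, f (varU C p q) = fv p q.
Let g p q : {rmorphism poly4 C -> E} := (f \o inst_hom p q)%FUN.

Let gt p q i : g p q (mpoly.mpolyC 4 (av i)) = fc i.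
Proof. by rewrite -fcE /g /= mpoly.mmapC. Qed.
Let gv p q i j : g p q (vx C i j) = fv (p + i%:Z) (q + j%:Z).
Proof. by rewrite -fvE /g /= -inst_homE inst_vx. Qed.

Lemma f_instQ p q : f (inst p q Q) =
  Qf fc (fv p q) (fv (p + 1) q) (fv p (q + 1)) (fv (p + 1) (q + 1)).
Proof. by rewrite -[LHS]/(g p q Q) ev_Q !gv !addr0 /Qf !gt. Qed.
Lemma f_inst_Q11 p q : f (inst p q (pd true true Q)) =
  Af fc (fv p q) (fv (p + 1) q) (fv p (q + 1)).
Proof. by rewrite -[LHS]/(g p q _) ev_Q11 !gv !addr0 /Af !gt. Qed.
Lemma f_inst_Q01 p q : f (inst p q (pd false true Q)) =
  Af fc (fv (p + 1) q) (fv p q) (fv (p + 1) (q + 1)).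
Proof. by rewrite -[LHS]/(g p q _) ev_Q01 !gv !addr0 /Af !gt. Qed.
Lemma f_inst_Q10 p q : f (inst p q (pd true false Q)) =
  Af fc (fv p (q + 1)) (fv (p + 1) (q + 1)) (fv p q).
Proof. by rewrite -[LHS]/(g p q _) ev_Q10 !gv !addr0 /Af !gt. Qed.
Lemma f_inst_Q00 p q : f (inst p q (pd false false Q)) =
  Af fc (fv (p + 1) (q + 1)) (fv p (q + 1)) (fv (p + 1) q).
Proof. by rewrite -[LHS]/(g p q _) ev_Q00 !gv !addr0 /Af !gt. Qed.
Lemma f_inst_h p q : f (inst p q (hpoly Q)) = hf fc (fv p q) (fv (p + 1) q).
Proof. by rewrite -[LHS]/(g p q _) ev_h !gv !addr0 /hf /d2f !gt. Qed.
Lemma f_inst_dh p q : f (inst p q (pd true false (hpoly Q))) =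
  dhf fc (fv p q) (fv (p + 1) q).
Proof. by rewrite -[LHS]/(g p q _) ev_dh !gv !addr0 /dhf /d2f !gt. Qed.
End InstEval.

Lemma proj_J a : proj a = 0 <-> JQ Q a.
Proof. exact: fracF.1. Qed.

Lemma t_cst i : proj (cstU (av i)) = t i. Proof. by []. Qed.
Lemma u_var p q : proj (varU C p q) = u p q. Proof. by []. Qed.

Lemma u_Q p q : Qf t (u p q) (u (p + 1) q) (u p (q + 1)) (u (p + 1) (q + 1)) = 0.
Proof.
rewrite -(f_instQ t_cst u_var); apply/proj_J; exists [:: (1, (p, q))].
by rewrite big_seq1 mul1r.
Qed.

Lemma u_induct (P : F -> Prop) : (forall c, P (csr c)) -> (forall p q, P (u p q)) ->
  (forall x y, P x -> P y -> P (x + y)) -> (forall x y, P x -> P y -> P (x * y)) ->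
  (forall x, P x -> P x^-1) -> forall x, P x.
Proof.
move=> Pc Pu PD PM PV x; have [a [b [_ ->]]] := fracF.2 x.
have Pp c : P (proj c).
  elim/CU_ind: c => [c|p q|c d|c d]; [exact (Pc c) | exact (Pu p q) | |].
    by rewrite rmorphD; apply: PD.
  by rewrite rmorphM; apply: PM.
exact: PM (Pp a) (PV _ (Pp b)).
Qed.

Lemma F_hom_ext (E : fieldType) (f g : {rmorphism F -> E}) :
  (forall c, f (csr c) = g (csr c)) -> (forall p q, f (u p q) = g (u p q)) ->
  f =1 g.
Proof.
move=> fc fu; elim/u_induct => // [x y|x y|x].
- by rewrite !rmorphD => -> ->.
- by rewrite !rmorphM => -> ->.
- by rewrite !fmorphV => ->.
Qed.

Lemma sh_u p q i j : sh p q (u i j) = u (i + p) (j + q).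
Proof. exact: (shP p q).2. Qed.
Lemma sh_c p q c : sh p q (csr c) = csr c.
Proof. exact: (shP p q).1. Qed.
Lemma sh_t p q i : sh p q (t i) = t i.
Proof. exact: sh_c. Qed.

Lemma sh_sh p q p' q' x : sh p q (sh p' q' x) = sh (p + p') (q + q') x.
Proof.
rewrite -[LHS]/((sh p q \o sh p' q')%FUN x); apply: F_hom_ext => [c|i j] /=.
  by rewrite !sh_c.
by rewrite !sh_u -!addrA [p' + p]addrC [q' + q]addrC.
Qed.
Lemma sh0 x : sh 0 0 x = x.
Proof.
rewrite -[RHS]/(idfun x); apply: F_hom_ext => [c|i j] /=; first exact: sh_c.
by rewrite sh_u !addr0.
Qed.

Section Eval.
Variables (E : fieldType) (f : {rmorphism C -> E}) (U : int -> int -> E).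
Hypothesis solU : forall p q, Qf (f \o av) (U p q) (U (p + 1) q) (U p (q + 1)) (U (p + 1) (q + 1)) = 0.

Lemma evU_cst_av i : evU f U (cstU (av i)) = (f \o av) i.
Proof. exact: evU_cst. Qed.

Lemma evU_kill a : proj a = 0 -> evU f U a = 0.
Proof.
move/proj_J => [s ->]; rewrite rmorph_sum big1 // => i _.
by rewrite rmorphM (f_instQ evU_cst_av (evU_var f U)) solU mulr0.
Qed.
End Eval.

Section Periodic.
Variables x X y Y : C.
Hypothesis q0 : Qf av x X y Y = 0.
Definition periodic (p q : int) : C :=
  if odd `|q| then (if odd `|p| then Y else y) else (if odd `|p| then X else x).
Lemma periodic_solution p q : Qf (idfun \o av) (periodic p q) (periodic (p + 1) q)
  (periodic p (q + 1)) (periodic (p + 1) (q + 1)) = 0.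
Proof.
rewrite /periodic !odd_absz1; case: odd; case: odd => //=; rewrite -q0 /Qf /=; ring.
Qed.
Lemma periodic_eval a : proj a = 0 -> evU idfun periodic a = 0.
Proof. exact: evU_kill periodic_solution a. Qed.
End Periodic.

(** A multi-affine polynomial vanishing on the vertices of the unit cube is zero; its coefficients
    are recovered in order of degree. *)
Lemma Af_nonzero : exists x X y, Af av x X y != 0.
Proof.
have [ex|nex] := boolP [exists b : bool * bool * bool, Af av b.1.1%:R b.1.2%:R b.2%:R != 0].
  by case/existsP: ex => b nb; exists b.1.1%:R, b.1.2%:R, b.2%:R.
move: nex; rewrite negb_exists => /forallP nex; exfalso; apply/negP: dQ.
have A0 (a b c : bool) : Af av a%:R b%:R c%:R = 0.
  by apply/eqP; have := nex (a, b, c); rewrite negbK.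
have e6 : av 6 = 0.
  by rewrite -(A0 false false false) /Af /=; ring.
have e4 : av 4 = 0.
  by rewrite -[RHS](A0 true false false) -[LHS]addr0 -{1}e6 /Af /=; ring.
have e5 : av 5 = 0.
  by rewrite -[RHS](A0 false true false) -[LHS]addr0 -{1}e6 /Af /=; ring.
have e3 : av 3 = 0.
  by rewrite -[RHS](A0 false false true) -[LHS]addr0 -{1}e6 /Af /=; ring.
have e2 : av 2 = 0.
  by rewrite -[RHS](A0 true true false) /Af e3 e4 e5 e6 /=; ring.
have e1 : av 1 = 0.
  by rewrite -[RHS](A0 true true true) /Af e2 e3 e4 e5 e6 /=; ring.
by rewrite pd11_Q e1 e2 e3 e4 e5 e6 !scale0r !addr0 eqxx.
Qed.

(* A solution of period 2 in both directions is determined by four values with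
   [Q = 0], hence gives points of the variety at which a derivative of [Q] is
   nonzero. *)
Lemma u_A00 (a b : bool) :
  Af t (u a%:Z b%:Z) (u (~~ a)%:Z b%:Z) (u a%:Z (~~ b)%:Z) != 0.
Proof.
have [x [X [y nA]]] := Af_nonzero.
have q0 := solveP nA; set Y := solve _ _ _ _ in q0.
pose c : CU C := inst 0 0 (pd (~~ a) (~~ b) Q).
have pc : proj c = Af t (u a%:Z b%:Z) (u (~~ a)%:Z b%:Z) (u a%:Z (~~ b)%:Z).
  rewrite /c; case: (a); case: (b) => /=.
  - by rewrite (f_inst_Q00 t_cst u_var) !add0r.
  - by rewrite (f_inst_Q01 t_cst u_var) !add0r.
  - by rewrite (f_inst_Q10 t_cst u_var) !add0r.
  - by rewrite (f_inst_Q11 t_cst u_var) !add0r.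
rewrite -pc; apply/eqP => c0.
have [z [Z [v [V [qz]]]]] : exists z Z v V, Qf av z Z v V = 0 /\ evU idfun (periodic z Z v V) c = Af av x X y.
  case: (a) @c {pc c0} => c; case: (b) @c => c.
  - exists Y, y, X, x; split; first by rewrite -q0 /Qf; ring.
    exact: (f_inst_Q00 (evU_cst_av idfun _) (evU_var idfun _)).
  - exists X, x, Y, y; split; first by rewrite -q0 /Qf; ring.
    exact: (f_inst_Q01 (evU_cst_av idfun _) (evU_var idfun _)).
  - exists y, Y, x, X; split; first by rewrite -q0 /Qf; ring.
    exact: (f_inst_Q10 (evU_cst_av idfun _) (evU_var idfun _)).
  - exists x, X, y, Y; split => //.
    exact: (f_inst_Q11 (evU_cst_av idfun _) (evU_var idfun _)).
by rewrite (periodic_eval qz c0) => /esym/eqP; rewrite (negbTE nA).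
Qed.

#[local] Opaque u.
(** Otherwise [u 0 0 + u 1 0] is invariant under [S], hence a constant [c]. Solutions of period 2
    then give [x + X = c] wherever [Af] is nonzero, which fails when [x] moves by 1. *)
Lemma u_step2_neq : u 1 0 != u (- 1) 0.
Proof.
apply/eqP => e.
have e2 : u 2 0 = u 0 0.
  have E1 : sh 1 0 (u 1 0) = u 2 0 by rewrite sh_u; congr u.
  have E2 : sh 1 0 (u (- 1) 0) = u 0 0 by rewrite sh_u; congr u.
  by rewrite -E1 -E2 e.
have e3 : sh 1 0 (u 0 0 + u 1 0) = u 0 0 + u 1 0.
  have E1 : sh 1 0 (u 1 0) = u 2 0 by rewrite sh_u; congr u.
  have E2 : sh 1 0 (u 0 0) = u 1 0 by rewrite sh_u; congr u.
  have gen (f : {rmorphism F -> F}) a b c : f a = b -> f b = c -> c = a -> f (a + b) = a + b.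
    by move=> fa fb ca; rewrite rmorphD fa fb ca addrC.
  exact: gen E2 E1 e2.
have [c ec] := kerDelta e3.
have k0 : proj (varU C 0 0 + varU C 1 0 - cstU c) = 0.
  by rewrite rmorphB rmorphD; apply/eqP; rewrite subr_eq0; apply/eqP.
have sumc x X y : Af av x X y != 0 -> x + X = c.
  move=> nA; have k := periodic_eval (solveP nA) k0.
  have gen (f : {rmorphism CU C -> C}) a b d x' X' c' : f (a + b - d) = 0 ->
      f a = x' -> f b = X' -> f d = c' -> x' + X' = c'.
    by move=> f0 <- <- <-; apply/eqP; rewrite -subr_eq0 -rmorphD -rmorphB f0.
  exact: gen k (evU_var idfun _ 0 0) (evU_var idfun _ 1 0) (evU_cst idfun _ c).
have [x [X [y nA]]] := Af_nonzero.
(* [Af] is affine in [x]: if it vanishes at [x + 1], its value at [x - 1] is twice the value at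
   [x]. *)
have [n1|n1] := eqVneq (Af av (x + 1) X y) 0; last first.
  have : x + 1 + X - (x + X) = 0 by rewrite (sumc _ _ _ n1) (sumc _ _ _ nA) subrr.
  rewrite (_ : x + 1 + X - (x + X) = 1); last by ring.
  by move/eqP; rewrite oner_eq0.
have n2 : Af av (x - 1) X y != 0.
  rewrite (_ : Af _ _ _ _ = 2 * Af av x X y); first by rewrite mulf_neq0.
  by rewrite -[LHS]addr0 -n1 /Af; ring.
have : x + X - (x - 1 + X) = 0 by rewrite (sumc _ _ _ n2) (sumc _ _ _ nA) subrr.
rewrite (_ : x + X - (x - 1 + X) = 1); last by ring.
by move/eqP; rewrite oner_eq0.
Qed.

Lemma u_square_A p q (a b : bool) :
  Af t (u (p + a%:Z) (q + b%:Z)) (u (p + (~~ a)%:Z) (q + b%:Z))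
    (u (p + a%:Z) (q + (~~ b)%:Z)) != 0.
Proof.
have gen (f : {rmorphism F -> F}) x X y x' X' y' : (forall i, f (t i) = t i) ->
    f x = x' -> f X = X' -> f y = y' -> Af t x X y != 0 -> Af t x' X' y' != 0.
  by move=> ft <- <- <-; rewrite -(rmorph_Af ft) fmorph_eq0.
by apply: gen (sh_t p q) _ _ _ (u_A00 a b); rewrite sh_u (addrC p) (addrC q).
Qed.

Lemma finite_support K : exists N : int, forall (E : fieldType) (f g : {rmorphism F -> E}),
  (forall c, f (csr c) = g (csr c)) ->
  (forall p q, p < N -> q < N -> f (u p q) = g (u p q)) -> f K = g K.
Proof.
elim/u_induct: K => [c|p q|x y [N1 h1] [N2 h2]|x y [N1 h1] [N2 h2]|x [N h]].
- by exists 0 => E f g fc _; apply: fc.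
- exists (Num.max p q + 1) => E f g _; apply; rewrite ltzD1 le_max lexx ?orbT //.
- exists (Num.max N1 N2) => E f g fc fu; rewrite !rmorphD.
  by congr (_ + _); [apply: h1|apply: h2] => // p q ltp ltq; apply: fu; rewrite lt_max ?ltp ?ltq ?orbT.
- exists (Num.max N1 N2) => E f g fc fu; rewrite !rmorphM.
  by congr (_ * _); [apply: h1|apply: h2] => // p q ltp ltq; apply: fu; rewrite lt_max ?ltp ?ltq ?orbT.
- by exists N => E f g fc fu; rewrite !fmorphV; congr (_ ^-1); apply: h.
Qed.

Lemma u_sg_Q e d p q : Qf t (u (sg e p) (sg d q)) (u (sg e (p + 1)) (sg d q))
  (u (sg e p) (sg d (q + 1))) (u (sg e (p + 1)) (sg d (q + 1))) = 0.
Proof.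
have m1 r : - (r + 1) + 1 = - r :> int by ring.
case: e; case: d => /=; last exact: u_Q.
- by have := u_Q (- (p + 1)) (- (q + 1)); rewrite !m1 => H; rewrite -Qf_swap_col -Qf_swap_row.
- by have := u_Q (- (p + 1)) q; rewrite m1 => H; rewrite -Qf_swap_col.
- by have := u_Q p (- (q + 1)); rewrite m1 => H; rewrite -Qf_swap_row.
Qed.

(** On [C[U]] the reflection [rho] is an involution mapping the kernel of [proj] into itself, so
    nothing outside that kernel is killed. *)
Lemma reflection e d : exists f : {rmorphism F -> F},
  (forall c, f (csr c) = csr c) /\ (forall p q, f (u p q) = u (sg e p) (sg d q)).
Proof.
pose psi := evU csr (fun p q => u (sg e p) (sg d q)).
pose rho := evU (@malgC _ C : {rmorphism C -> CU C}) (fun p q => varU C (sg e p) (sg d q)).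
have psi_kill a : proj a = 0 -> psi a = 0.
  by apply: evU_kill => p q; exact: (u_sg_Q e d p q).
have psi_rho a : psi a = proj (rho a).
  rewrite -[RHS]/((proj \o rho)%FUN a); apply: CU_hom_ext => [c|p q] /=.
    by rewrite /psi /rho evU_cst evU_cst.
  by rewrite /psi /rho evU_var evU_var.
have rhoK a : rho (rho a) = a.
  rewrite -[LHS]/((rho \o rho)%FUN a) -[RHS]/(idfun a); apply: CU_hom_ext => [c|p q] /=.
    have -> : rho (cstU c) = cstU c by exact: evU_cst.
    exact: evU_cst.
  have -> : rho (varU C p q) = varU C (sg e p) (sg d q) by exact: evU_var.
  by rewrite -[in RHS](sgK e p) -[in RHS](sgK d q); exact: evU_var.
have psi0 a : psi a = 0 <-> proj a = 0.
  split=> [pa0|]; last exact: psi_kill.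
  by rewrite -(rhoK a) -psi_rho; apply: psi_kill; rewrite -psi_rho.
have [f fE] := frac_lift fracF psi0; exists f; split=> [c|p q].
  by apply: (etrans (fE _)); exact: evU_cst.
by apply: (etrans (fE _)); exact: evU_var.
Qed.

(** [psi a] specializes at [s] to the reflected image of [proj a], so it can vanish only when
    [proj a] does. *)
Lemma lift_solution (E : fieldType) (inc : {rmorphism {poly F} -> E}) s e d
    (U : int -> int -> E) : injective inc ->
  (forall p q, Qf (fun i => inc (t i)%:P) (U p q) (U (p + 1) q) (U p (q + 1)) (U (p + 1) (q + 1)) = 0) ->
  (forall p q, has_residue inc s (U p q) (u (sg e p) (sg d q))) ->
  exists f : {rmorphism F -> E},
  (forall c, f (csr c) = inc (csr c)%:P) /\ (forall p q, f (u p q) = U p q).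
Proof.
move=> inc_inj solU resU.
pose cE : {rmorphism C -> E} := (inc \o (polyC \o csr))%FUN.
pose psi := evU cE U.
have [rf [rfc rfu]] := reflection e d.
have psi_kill a : proj a = 0 -> psi a = 0 by exact: evU_kill.
have res a : has_residue inc s (psi a) (rf (proj a)).
  elim/CU_ind: a => [c|p q|a b ra rb|a b ra rb].
  - have -> : psi (cstU c) = inc (csr c)%:P by exact: evU_cst.
    by have -> : rf (proj (cstU c)) = csr c; [exact: rfc | exact: residue_const].
  - have -> : psi (varU C p q) = U p q by exact: evU_var.
    by have -> : rf (proj (varU C p q)) = u (sg e p) (sg d q); [exact: rfu | exact: resU].
  - by rewrite !rmorphD; apply: residueD.
  - by rewrite !rmorphM; apply: residueM.
have psi0 a : psi a = 0 <-> proj a = 0.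
  split=> [pa0|]; last exact: psi_kill.
  apply/eqP; apply: contraTT isT => na; rewrite -(fmorph_eq0 rf) in na.
  by have := residue_neq0 inc_inj (res a) na; rewrite pa0 eqxx.
have [f fE] := frac_lift fracF psi0; exists f; split=> [c|p q].
  by apply: (etrans (fE _)); exact: evU_cst.
by apply: (etrans (fE _)); exact: evU_var.
Qed.
End Lattice.

(** * The recursion operator of the Viallet equation *)

Section Viallet.
Variables (C : fieldType) (av : nat -> C).
Hypotheses (two_neq0 : 2 != 0 :> C) (three_neq0 : 3 != 0 :> C).
Local Notation Q :=
  (viallet (av 1) (av 2) (av 3) (av 4) (av 5) (av 6) (av 7)).
Hypothesis dQ : pd true true Q != 0.
Variables (F : fieldType) (proj : {rmorphism CU C -> F}).
Hypothesis fracF : is_frac_of_quotient (JQ Q) proj.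
Variable sh : int -> int -> {rmorphism F -> F}.
Hypothesis shP : is_shift_action proj sh.
Hypothesis kerDelta : KerDelta_is_C proj sh.

Let cs := csr proj.
Let t := t av proj.
Let u := u proj.

Let two_F : 2 != 0 :> F.
Proof. by rewrite -(rmorph_nat cs) fmorph_eq0. Qed.
Let three_F : 3 != 0 :> F.
Proof. by rewrite -(rmorph_nat cs) fmorph_eq0. Qed.

Let shc p q c : sh p q (cs c) = cs c := sh_c shP p q c.
Let sht p q i : sh p q (t i) = t i := sh_t av shP p q i.
Let shu p q i j : sh p q (u i j) = u (i + p) (j + q) := sh_u shP p q i j.
Let shsh p q p' q' x : sh p q (sh p' q' x) = sh (p + p') (q + q') x :=
  sh_sh fracF shP p q p' q' x.
Let sh00 x : sh 0 0 x = x := sh0 fracF shP x.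
Let hom_ext (E : fieldType) (f g : {rmorphism F -> E})
  (fc : forall c, f (cs c) = g (cs c)) (fu : forall p q, f (u p q) = g (u p q)) :
  f =1 g := F_hom_ext fracF fc fu.
Let squareA := u_square_A dQ fracF shP.
Let Qu := u_Q fracF.

Lemma sym_rF K th1 th2 : sym t u sh K ->
  sh 1 0 th1 - th1 = (mF t u sh * sh 1 0 K - sh 1 0 (mF t u sh) * K) / hF t u ->
  sh 1 0 th2 - th2 = (kF t u * sh 1 0 K - sh 1 0 (kF t u) * K) / hF t u ->
  sym t u sh (rF t u sh K th1 th2).
Proof.
move=> sK th1P th2P.
have t_cs i : exists c, t i = cs c by exists (av i).
have [rf rfP] := fin_all_exists (fun x : bool * bool => reflection fracF x.1 x.2).
pose rf2 e d := rf (e, d).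
have rfc e d c : rf2 e d (cs c) = cs c by exact: (rfP (e, d)).1.
have rfu e d p q : rf2 e d (u p q) = u (sg e p) (sg d q) by exact: (rfP (e, d)).2.
have rft e d i : rf2 e d (t i) = t i by exact: rfc.
have rfrf x : rf2 true false (rf2 false true x) = rf2 true true x.
  apply: (hom_ext (f := (rf2 true false \o rf2 false true)%FUN)) => [c|p q] /=.
    by rewrite !rfc.
  by rewrite !rfu.
have A0 : cA t u != 0 by have := squareA 0 0 false false.
apply: (rF_sym shc sht shu shsh sh00 two_F squareA Qu
  (u_step2_neq two_neq0 dQ fracF shP kerDelta) rfc rft rfu
  (rf_sh shc shu hom_ext rfc rfu) rfrf kerDelta
  (sym_rf shc sht shu shsh sh00 t_cs hom_ext rfc rfu) _ sK th1P th2P) => K' sK'.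
exact: (reflection_vanish shc sht shu shsh sh00 t_cs (finite_support fracF) A0 two_F three_F
  squareA (u_sg_Q fracF) hom_ext rfc rfu (lift_solution fracF) sK').
Qed.

Lemma symmetryE K : symmetry Q proj sh K = sym t u sh K.
Proof.
have gen (d11 d10 d01 d00 a b c d k11 k10 k01 k00 k : F) : d11 = a -> d10 = c ->
    d01 = b -> d00 = d -> k00 = k ->
    d11 * k11 + d10 * k10 + (d01 * k01 + d00 * k00)
    = d * k + b * k01 + c * k10 + a * k11.
  by move=> -> -> -> -> ->; ring.
rewrite /symmetry; have -> : DQ Q proj sh K = cD t u * K + cB t u * sh 0 1 K + cC t u * sh 1 0 K + cA t u * sh 1 1 K.
  rewrite /DQ !big_bool; apply: gen (sh00 K).
  - by rewrite (f_inst_Q11 (t_cst av proj) (u_var proj)) !add0r.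
  - by rewrite (f_inst_Q10 (t_cst av proj) (u_var proj)) !add0r.
  - by rewrite (f_inst_Q01 (t_cst av proj) (u_var proj)) !add0r.
  - by rewrite (f_inst_Q00 (t_cst av proj) (u_var proj)) !add0r.
by [].
Qed.

Lemma hE : h Q proj = hF t u.
Proof. by rewrite /h (f_inst_h (t_cst av proj) (u_var proj)) add0r. Qed.
Lemma wE : w proj = wF u.
Proof. by rewrite /w rmorphB. Qed.
Lemma K1E : K1 Q proj = kF t u / 2.
Proof.
rewrite /K1 hE wE (f_inst_dh (t_cst av proj) (u_var proj)) add0r /kF.
have gen (p q : F) : p - 2^-1 * q = (2 * p - q) / 2 by field.
exact: gen.
Qed.
Lemma K2E : K2 Q proj sh = mF t u sh.
Proof. by rewrite /K2 hE wE. Qed.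

Lemma recursion_viallet : recursion_operator Q proj sh (opR Q proj sh).
Proof.
move=> K; rewrite symmetryE => sK _ r [bs [sz bsP ->]].
case: bs sz bsP => [|b1 [|b2 []]] //= _ bsP.
have /= b1P := bsP 0%N isT; have /= b2P := bsP 1%N isT.
rewrite /shS K1E K2E hE in b1P b2P *; rewrite wE.
set hh := hF t u in b1P b2P *; set ww := wF u.
set kk := kF t u in b1P b2P *; set mm := mF t u sh in b1P b2P *.
rewrite symmetryE.
rewrite !big_cons big_nil big_ord_recl big_ord_recl big_ord0 /=.
(* For [f = K2] or [f = 2 K1], the density [(f K_1 - f_1 K) / h] exceeds the nonlocal one of [opR]
   by [Delta(f_{-1} K / h_{-1})], whence the correction. The factor 2 on [b2] is that of
   [kk = 2 K1]. *)
pose th1 := b1 + sh (- 1) 0 mm * K / sh (- 1) 0 hh.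
pose th2 := 2 * b2 + sh (- 1) 0 kk * K / sh (- 1) 0 hh.
have half p q : sh p q (kk / 2) = sh p q kk / 2.
  have gen (f : {rmorphism F -> F}) x : f (x / 2) = f x / 2.
    by rewrite fmorph_div rmorph_nat.
  exact: gen.
rewrite !half in b2P *.
have dS (f : F) : (sh (- 1) 0 f / sh (- 1) 0 hh - sh 1 0 f / hh) * K =
    (f * sh 1 0 K - sh 1 0 f * K) / hh
    - (sh 1 0 (sh (- 1) 0 f * K / sh (- 1) 0 hh) - sh (- 1) 0 f * K / sh (- 1) 0 hh).
  have gen (g : {rmorphism F -> F}) x y z : g (x * y / z) = g x * g y / g z.
    by rewrite fmorph_div rmorphM.
  rewrite gen !shsh /=.
  have e1 : sh (-1 + 1) (0+0) f = f by exact: sh00.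
  have e2 : sh (-1 + 1) (0+0) hh = hh by exact: sh00.
  rewrite e1 e2. ring.
have th1P : sh 1 0 th1 - th1 = (mm * sh 1 0 K - sh 1 0 mm * K) / hh.
  rewrite /th1 rmorphD opprD addrACA b1P dS; ring.
have th2P : sh 1 0 th2 - th2 = (kk * sh 1 0 K - sh 1 0 kk * K) / hh.
  have e : 2 * (sh 1 0 b2 - b2) = (sh (- 1) 0 kk / sh (- 1) 0 hh - sh 1 0 kk / hh) * K.
    rewrite b2P; have gen (p q y s v : F) : 2 * ((p / 2 * q - y / 2 * s) * v) = (p * q - y * s) * v by field.
    exact: gen.
  rewrite dS in e.
  rewrite /th2 rmorphD rmorphM rmorph_nat.
  transitivity (2 * (sh 1 0 b2 - b2) + (sh 1 0 (sh (- 1) 0 kk * K / sh (- 1) 0 hh) - sh (- 1) 0 kk * K / sh (- 1) 0 hh)); first by ring.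
  by rewrite e; ring.
have key X : X = rF t u sh K th1 th2 -> sym t u sh X.
  by move=> ->; exact: sym_rF.
apply: key.
rewrite /rF -/hh -/ww -/kk -/mm /th1 /th2 sh00.
rewrite (_ : 2 * (kk / 2) = kk); last by field.
have gen (p q y s v : F) : 2 * p * (q / 2 * y + s * (v / 2)) = (q * y + s * v) * p.
  by field.
rewrite gen; ring.
Qed.
End Viallet.

Theorem theorem1 (R : realType) (a1 a2 a3 a4 a5 a6 a7 : complex R)
  (Q : poly4 (complex R))
  (defQ : Q = viallet a1 a2 a3 a4 a5 a6 a7)
  (irrQ : irreducible_elt Q)
  (dQ : forall i j : bool, pd i j Q != 0)
  (F : fieldType) (proj : {rmorphism CU (complex R) -> F})
  (fracF : is_frac_of_quotient (JQ Q) proj)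
  (sh : int -> int -> {rmorphism F -> F})
  (shP : is_shift_action proj sh)
  (kerDelta : KerDelta_is_C proj sh) :
  recursion_operator Q proj sh (opR Q proj sh).
Proof.
(* The leading 0 aligns index [i] with the parameter [a_i]. *)
subst Q; pose av i := nth 0 [:: 0; a1; a2; a3; a4; a5; a6; a7] i.
have nz k : (k.+1%:R : complex R) != 0 by rewrite pnatr_eq0.
exact: (recursion_viallet (av := av) (nz 1) (nz 2) (dQ true true) fracF shP kerDelta).
Qed.
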